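(* Let $K$ be the algebraic closure of a finite field $\mathbb{F}_q$ of characteristic $p$. Let $\alpha_1,\dots,\alpha_r\in K$ be pairwise distinct, let $m$ be a positive integer with $p\nmid m$, let $\lambda_1,\dots,\lambda_r$ be integers with $1\le\lambda_i<m$, set $\lambda_0:=\sum_{i=1}^r\lambda_i$ and suppose $\gcd(m,\lambda_0)=1$. Let $\mathcal{F}=K(x,y)$ be the function field of the curve $y^m=\prod_{i=1}^r(x-\alpha_i)^{\lambda_i}$. Suppose that $\gcd(m,\lambda_\ell)=1$ for some $1\le\ell\le r$, let $1\le\lambda\le m-1$ be the inverse of $\lambda_\ell$ modulo $m$, and let $Q_\ell$ be the unique place of $\mathcal{F}$ lying over the zero $P_\ell$ of $x-\alpha_\ell$ in $K(x)$. Then $$G(Q_\ell)=\left\{i+mj\ \middle|\ 1\le i\le m-1,\ 0\le j\le\left(\sum_{k=1}^r\left\lceil\frac{i\lambda\lambda_k}{m}\right\rceil\right)-\left\lceil\frac{i\lambda\lambda_0}{m}\right\rceil-1\right\},$$ where $i,j$ range over integers.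
   Context: $\mathbb{N}=\{0,1,2,\dots\}$. For a place $P$ of the function field $\mathcal{F}/K$, the Weierstrass semigroup is $H(P)=\{s\in\mathbb{N}\mid (z)_\infty=sP\text{ for some }z\in\mathcal{F}\}$, where $(z)_\infty$ is the pole divisor of $z$, and the gap set is $G(P)=\mathbb{N}\setminus H(P)$. $\lceil\cdot\rceil$ is the ceiling function. When $\gcd(m,\lambda_\ell)=1$, the place $P_\ell$ is totally ramified in $\mathcal{F}/K(x)$. *)

(* Defs.v *)
From HB Require Import structures.
From mathcomp Require Import all_boot all_order all_algebra all_field.
From mathcomp Require Import boolp classical_sets functions.

Set Implicit Arguments.
Unset Strict Implicit.
Unset Printing Implicit Defensive.

Import Order.TTheory GRing.Theory Num.Theory.
Local Open Scope classical_set_scope.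
Local Open Scope ring_scope.

(* Conventions for places and valuations follow Stichtenoth, "Algebraic
   Function Fields and Codes", Chapter 1.  A function field F/K is a field F
   together with the embedding k : K -> F of the constants. *)

Section ValuationRings.
Variables (K F : fieldType) (k : {rmorphism K -> F}).
Implicit Types O I : set F.

Definition valuation_ring O : Prop :=
  [/\ subring_closed (mem O), range k `<` O, O `<` [set: F] &
      forall z, O z \/ O z^-1].

Definition ideal_of O I : Prop :=
  [/\ I `<=` O, I 0, forall a b, I a -> I b -> I (a + b) &
      forall a b, O a -> I b -> I (a * b)].

Definition maximal_ideal_of O I : Prop :=
  [/\ ideal_of O I, ~ I 1 &
      forall J, ideal_of O J -> ~ J 1 -> I `<=` J -> J = I].

(* A place is the maximal ideal of a valuation ring of F/K; since ideal and
   ring determine each other, both are recorded. *)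
Record place : Type := Place {
  place_ring : set F;
  place_ideal : set F;
  place_ringP : valuation_ring place_ring;
  place_idealP : maximal_ideal_of place_ring place_ideal }.

Definition prime_element (P : place) (t : F) : Prop :=
  place_ideal P = [set t * u | u in place_ring P].

Definition place_unit (P : place) (u : F) : Prop :=
  [/\ u != 0, place_ring P u & place_ring P u^-1].

(* v_P(z) for z != 0.  No n is admissible for z = 0, so the default gives
   v_P(0) = 0 here instead of +oo; as a result 0 has no zeros and no poles. *)
Definition valuation (P : place) (z : F) : int :=
  xget 0 [set n : int | exists t u,
    [/\ prime_element P t, place_unit P u & z = t ^ n * u]].

Definition is_zero (P : place) (z : F) : Prop := 0 < valuation P z.

(* Divisors are given by their coefficient functions, added pointwise; that
   only finitely many coefficients of a pole divisor are nonzero is a theorem,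
   not part of the encoding. *)
Definition prime_divisor (P : place) : place -> int :=
  fun P' => if `[< P' = P >] then 1 else 0.

Definition pole_divisor (z : F) : place -> int :=
  fun P => if valuation P z < 0 then - valuation P z else 0.

Definition weierstrass_semigroup (P : place) : set nat :=
  [set s : nat | exists z : F, pole_divisor z = prime_divisor P *+ s].

Definition gap_set (P : place) : set nat := ~` weierstrass_semigroup P.

End ValuationRings.

(* The place Q of the extension F of F0 (same constants) lies over P. *)
Definition lies_over (K F0 : fieldType) (k : {rmorphism K -> F0})
    (F : fieldExtType F0) (Q : place (in_alg F \o k)) (P : place k) : Prop :=
  forall f : F0, place_ideal P f -> place_ideal Q f%:A.

Definition ratfun (K : fieldType) : fieldType := {fraction {poly K}}.

Definition ratfun_const (K : fieldType) : {rmorphism K -> ratfun K} :=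
  @tofrac {poly K} \o polyC.

Definition ratfun_of_poly (K : fieldType) (f : {poly K}) : ratfun K :=
  tofrac f.

Definition is_algebraic_closure (k : fieldType) (K : closedFieldType)
    (iota : {rmorphism k -> K}) : Prop :=
  forall a : K, algebraicOver iota a.

(* Main.v *)
Require Import Defs.
From HB Require Import structures.
From mathcomp Require Import all_boot all_order all_algebra all_field.
From mathcomp Require Import boolp classical_sets functions.
From mathcomp Require Import ring zify.

Set Implicit Arguments.
Unset Strict Implicit.
Unset Printing Implicit Defensive.

Import Order.TTheory GRing.Theory Num.Theory.
Local Open Scope classical_set_scope.
Local Open Scope ring_scope.

(** The function [w = 1 / (x - alpha l)] has its only pole at the place in question,
    so the Weierstrass semigroup consists of the pole orders there of the elements
    regular at every place where [w] is. These elements form the integral closure of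
    K[w], and the gaps are found by computing this ring together with the pole orders
    of its elements.

    Put [Y = y * w ^+ lambda0]. Then [Y ^+ m = G(w)] for a polynomial [G] whose roots
    are the images [beta k] of the other zeros of the curve, with multiplicity
    [mu k = lambda k], and the image 0 of infinity, with multiplicity
    [(m - 1) * lambda0]; its degree [D] is congruent to [- lambda l], hence prime to
    [m]. At a place where [w] has a pole, some product of powers of [Y] and [w] has
    value 1, the terms [h_i * Y ^+ i] with [i < m] have pole orders
    [m * deg h_i + i * D], which differ modulo [m], and the largest of them is the
    pole order of the sum ([dominant_term]). Hence there is only one such place
    ([pole_place_unique]), the powers [1, Y, ..., Y ^+ m.-1] are independent, and all
    pole orders are explicit.

    Regularity elsewhere means integrality ([integral_of_pole_divisor],
    [pole_divisor_integral]): a nonintegral element is left out by some valuation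
    ring containing K[w] ([exists_place]), and the place obtained is discrete, so
    that the element has a pole there in the sense of valuations. Discreteness
    ([finite_place_discrete]) holds because two terms of an algebraic equation over
    K(w) must have equal values, which bounds the ramification.

    Since the characteristic does not divide [m], averaging over the substitutions
    of [zeta * Y] for [Y], with [zeta] an [m]-th root of unity, shows that an integral
    element has integral terms ([integral_term]). A term [h * Y ^+ i] is integral iff
    [h ^+ m * G(w) ^+ i] is a polynomial in [w], that is, iff [h] becomes a polynomial
    when multiplied by the product of the [(w - beta k) ^+ (i * mu k %/ m)]. So [n] is
    a nongap iff it equals [i * D - m * \sum_k (i * mu k %/ m) + m * d] for some
    [i < m] and [d >= 0] ([pole_semigroupE]). Each residue class of [n] modulo [m]
    determines [i], and for [n] congruent to [i0], where [i] is [- i0 * lam] modulo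
    [m], the floors turn into the ceilings of the statement ([pole_gapE]). *)

(** * Valuation rings and their ideals *)

Section ValuationRingIdeal.
Variables (K F : fieldType) (k : {rmorphism K -> F}).
Implicit Types (O I : set F) (a b z : F).

Definition subring O : Prop :=
  [/\ O 1, forall a b, O a -> O b -> O (a - b) & forall a b, O a -> O b -> O (a * b)].

Lemma subring_closedP O : subring_closed (mem O) <-> subring O.
Proof.
split=> -[O1 OB OM]; split.
- exact: set_mem.
- by move=> a b /mem_set Oa /mem_set Ob; apply: set_mem; exact: OB.
- by move=> a b /mem_set Oa /mem_set Ob; apply: set_mem; exact: OM.
- exact: mem_set.
- by move=> a b /set_mem Oa /set_mem Ob; apply: mem_set; exact: OB.
- by move=> a b /set_mem Oa /set_mem Ob; apply: mem_set; exact: OM.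
Qed.

Lemma subring0 O : subring O -> O 0.
Proof. by case=> O1 OB _; rewrite -(subrr 1); exact: OB. Qed.

Lemma subringD O a b : subring O -> O a -> O b -> O (a + b).
Proof.
move=> sO Oa Ob; have [_ OB _] := sO.
by rewrite -[b]opprK -[- b]sub0r; do 2![apply: (OB) => //]; exact: subring0.
Qed.

Lemma subring_sum O (J : Type) (s : seq J) (A : pred J) (f : J -> F) :
  subring O -> (forall i, A i -> O (f i)) -> O (\sum_(i <- s | A i) f i).
Proof.
by move=> sO Of; apply: big_ind => //; [exact: subring0 | move=> *; exact: subringD].
Qed.

Definition nonunits O : set F := [set z | O z /\ (z != 0 -> ~ O z^-1)].

(** Nonunits are closed under addition because one of [a / b], [b / a] always
    lies in a valuation ring. *)
Lemma nonunits_ideal O : valuation_ring k O -> ideal_of O (nonunits O).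
Proof.
move=> [/subring_closedP sO _ _ Ototal]; have [O1 _ OM] := sO.
have O0 := subring0 sO; have OD a b := @subringD O a b sO.
split=> [z []||a b|a b Oa [Ob nUb]] //; first by split=> //; rewrite eqxx.
  wlog ab : a b / O (a / b) => [wl Ja Jb|[Oa nUa] [Ob nUb]].
    have [|] := Ototal (a / b); first by move=> ab; apply: wl.
    by rewrite invf_div addrC => ba; apply: wl.
  split=> [|ab0 Oabi]; first exact: OD.
  have [b0|b0] := eqVneq b 0.
    by move: ab0 Oabi; rewrite b0 addr0; exact: nUa.
  apply: nUb => //; have -> : b^-1 = (a / b + 1) * (a + b)^-1.
    by rewrite -[X in _ + X](divff b0) -mulrDl mulrAC divff // mul1r.
  by apply: OM => //; exact: OD.
split=> [|ab0 Oabi]; first exact: OM.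
have [a0 b0] : a != 0 /\ b != 0 by apply/andP; rewrite -negb_or -mulf_eq0.
apply: nUb => //.
have -> : b^-1 = a * (a * b)^-1 by rewrite invfM mulrA divff // mul1r.
exact: OM.
Qed.

Lemma proper_ideal_nonunits O I :
  ideal_of O I -> ~ I 1 -> I `<=` nonunits O.
Proof.
move=> [IO _ _ IM] I1 z Iz; split=> [|z0 Ozi]; first exact: IO.
by apply: I1; rewrite -(mulVf z0); exact: IM.
Qed.

Lemma nonunits_maximal O : valuation_ring k O -> maximal_ideal_of O (nonunits O).
Proof.
move=> Oval; split; first exact: nonunits_ideal.
  case: Oval => /subring_closedP[O1 _ _] _ _ _ [_].
  by rewrite oner_eq0 invr1; apply.
by move=> J Jid J1 sub; apply/seteqP; split=> //; exact: proper_ideal_nonunits.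
Qed.

Lemma maximal_idealE O I :
  valuation_ring k O -> maximal_ideal_of O I -> I = nonunits O.
Proof.
move=> Oval [Iid I1 Imax]; apply/esym/Imax; first exact: nonunits_ideal.
  by have [] := nonunits_maximal Oval.
exact: proper_ideal_nonunits.
Qed.

(** The ideal is recovered as the set of nonunits. *)
Lemma place_eq (P P' : place k) : place_ring P = place_ring P' -> P = P'.
Proof.
case: P P' => [O I Oval Imax] [O' I' Oval' Imax'] /= OO'.
have II' : I = I'.
  by rewrite (maximal_idealE Oval Imax) (maximal_idealE Oval' Imax') OO'.
by subst O' I'; congr Place; exact: Prop_irrelevance.
Qed.

End ValuationRingIdeal.

Section PlaceTheory.
Variables (K F : fieldType) (k : {rmorphism K -> F}) (P : place k).
Implicit Types (a b z u t : F).

Local Notation O := (place_ring P).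
Local Notation M := (place_ideal P).
Local Notation U := (place_unit P).

Lemma ring1 : O 1.
Proof. by have [/subring_closedP[]] := place_ringP P. Qed.

Lemma ringB a b : O a -> O b -> O (a - b).
Proof. by have [/subring_closedP[_ h _] _ _ _] := place_ringP P; exact: h. Qed.

Lemma ringM a b : O a -> O b -> O (a * b).
Proof. by have [/subring_closedP[_ _ h] _ _ _] := place_ringP P; exact: h. Qed.

Lemma ring0 : O 0.
Proof. by rewrite -(subrr 1); apply: ringB ring1 ring1. Qed.

Lemma ringN a : O a -> O (- a).
Proof. by rewrite -sub0r; apply: ringB ring0. Qed.

Lemma ringD a b : O a -> O b -> O (a + b).
Proof. by move=> Oa Ob; rewrite -[b]opprK; apply/ringB/ringN. Qed.

Lemma ringX n a : O a -> O (a ^+ n).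
Proof.
by move=> Oa; elim: n => [|n IH]; rewrite ?expr0 ?exprS; [exact: ring1|exact: ringM].
Qed.

Lemma ring_const c : O (k c).
Proof. by have [_ [kO _] _ _] := place_ringP P; apply: kO; exists c. Qed.

Lemma ring_total z : O z \/ O z^-1.
Proof. by have [_ _ _] := place_ringP P. Qed.

Lemma ring_proper : exists z, ~ O z.
Proof. by have [_ _ [_ /existsNP[z /not_implyP[_ Oz]]] _] := place_ringP P; exists z. Qed.

Lemma idealE z : M z <-> O z /\ ~ U z.
Proof.
rewrite (maximal_idealE (place_ringP P) (place_idealP P)).
split=> -[Oz nU]; split=> //; first by case=> z0 _; exact: nU.
by move=> z0 Ozi; apply: nU.
Qed.

Lemma ideal_ring z : M z -> O z. Proof. by case/idealE. Qed.

Lemma unit_neq0 z : U z -> z != 0. Proof. by case. Qed.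

Lemma unit_ring z : U z -> O z. Proof. by case. Qed.

Lemma ideal_unit z : M z -> ~ U z. Proof. by case/idealE. Qed.

Lemma ideal_or_unit z : O z -> M z \/ U z.
Proof. by move=> Oz; have [?|Uz] := EM (U z); [right | left; apply/idealE]. Qed.

Lemma ideal0 : M 0.
Proof. by have [[]] := place_idealP P. Qed.

Lemma idealD a b : M a -> M b -> M (a + b).
Proof. by have [[_ _ h _] _ _] := place_idealP P; apply: h. Qed.

Lemma idealMl a b : O a -> M b -> M (a * b).
Proof. by have [[_ _ _ h] _ _] := place_idealP P; apply: h. Qed.

Lemma idealMr a b : M a -> O b -> M (a * b).
Proof. by move=> *; rewrite mulrC; apply: idealMl. Qed.

Lemma ideal_sum (I : Type) (s : seq I) (A : pred I) (f : I -> F) :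
  (forall i, A i -> M (f i)) -> M (\sum_(i <- s | A i) f i).
Proof. by move=> Of; apply: big_ind => //; [exact: ideal0 | exact: idealD]. Qed.

Lemma idealX n a : (0 < n)%N -> M a -> M (a ^+ n).
Proof.
by case: n => // n _ Ma; rewrite exprS; apply/idealMr/ringX/ideal_ring.
Qed.

Lemma ideal_not_inv z : M z -> z != 0 -> ~ O z^-1.
Proof. by move=> Mz z0 Ozi; apply: (ideal_unit Mz); split=> //; exact: ideal_ring. Qed.

Lemma not_ring_inv z : ~ O z -> M z^-1.
Proof.
have [Oz|Oz] := ring_total z => // nOz; apply/idealE; split=> //.
by case; rewrite invr_eq0 invrK.
Qed.

Lemma unit1 : U 1.
Proof. by split; rewrite ?oner_eq0 ?invr1 //; exact: ring1. Qed.

Lemma unitM a b : U a -> U b -> U (a * b).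
Proof.
move=> [a0 Oa Oai] [b0 Ob Obi]; split; rewrite ?mulf_neq0 ?invfM //; exact: ringM.
Qed.

Lemma unitV a : U a -> U a^-1.
Proof. by move=> [a0 Oa Oai]; split; rewrite ?invr_eq0 ?invrK. Qed.

Lemma unitX n a : U a -> U (a ^+ n).
Proof.
by move=> Ua; elim: n => [|n IH]; rewrite ?expr0 ?exprS; [exact: unit1|exact: unitM].
Qed.

Lemma unitXz (n : int) a : U a -> U (a ^ n).
Proof. by case: n => n Ua; [|apply: unitV]; exact: unitX. Qed.

Lemma unit_const c : c != 0 -> U (k c).
Proof.
by move=> c0; split; rewrite ?fmorph_eq0 -?fmorphV //; exact: ring_const.
Qed.

Lemma unitD u a : U u -> M a -> U (u + a).
Proof.
move=> Uu Ma; have [Mua|//] := ideal_or_unit (ringD (unit_ring Uu) (ideal_ring Ma)).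
case: (ideal_unit _ Uu); rewrite -[u](addrK a) -mulN1r.
by apply/idealD/idealMl => //; apply/ringN/ring1.
Qed.

Lemma ideal_expn n z : (0 < n)%N -> M (z ^+ n) -> M z.
Proof.
move=> n0 Mzn; have [z0|z0] := eqVneq z 0; first by rewrite z0; exact: ideal0.
have [Oz|Oz] := ring_total z.
  by have [//|/(unitX n)/(ideal_unit Mzn)] := ideal_or_unit Oz.
by case: (ideal_not_inv Mzn); rewrite ?expf_neq0 // -exprVn; exact: ringX.
Qed.

Lemma ring_expn n z : (0 < n)%N -> O (z ^+ n) -> O z.
Proof.
move=> n0 Ozn; have [//|nOz] := EM (O z).
have z0 : z != 0 by apply: contra_notN nOz => /eqP->; exact: ring0.
case: (ideal_not_inv (idealX n0 (not_ring_inv nOz))).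
  by rewrite expf_neq0 ?invr_eq0.
by rewrite exprVn invrK.
Qed.

Lemma unit_expn n z : (0 < n)%N -> U (z ^+ n) -> U z.
Proof.
move=> n0 Uzn; have [|//] := ideal_or_unit (ring_expn n0 (unit_ring Uzn)).
by move=> /(idealX n0)/ideal_unit/(_ Uzn).
Qed.

Lemma ring_div_total a b : a != 0 -> b != 0 -> ~ U (a / b) -> M (a / b) \/ M (b / a).
Proof.
move=> a0 b0 Uab; have [/ideal_or_unit[|//]|] := ring_total (a / b); first by left.
rewrite invf_div => /ideal_or_unit[|Uba]; [by right | case: Uab].
by rewrite -invf_div; exact: unitV.
Qed.

(** The strict triangle inequality: when no quotient of two terms is a unit, the
    terms have pairwise distinct values, so one of them divides all the others
    strictly and the sum has the value of that term. *)
Lemma sum_unit (I : eqType) (s : seq I) (f : I -> F) :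
    uniq s -> s != [::] -> (forall i, i \in s -> f i != 0) ->
    (forall i j, i \in s -> j \in s -> i != j -> ~ U (f i / f j)) ->
  exists i, [/\ i \in s, forall j, j \in s -> j != i -> M (f j / f i)
                & U ((\sum_(j <- s) f j) / f i)].
Proof.
elim: s => // i s IH /= /andP[i_s us] _ f0 fU; have fi0 : f i != 0 by rewrite f0 ?mem_head.
have [s0|sn0] := eqVneq s [::].
  exists i; rewrite s0 mem_head big_seq1 divff //; split=> //; last exact: unit1.
  by move=> j; rewrite inE => ->.
have [i0 [i0s Mi0 Ui0]] : exists i0, [/\ i0 \in s,
    forall j, j \in s -> j != i0 -> M (f j / f i0) & U ((\sum_(j <- s) f j) / f i0)].
  apply: IH => // [j js|a b sa sb]; first by apply: f0; rewrite inE js orbT.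
  by apply: fU; rewrite inE ?sa ?sb orbT.
have fi00 : f i0 != 0 by rewrite f0 // inE i0s orbT.
have ii0 : i != i0 by apply: contraNneq i_s => ->.
have Ui : ~ U (f i / f i0) by apply: fU; rewrite ?inE ?eqxx ?i0s ?orbT.
have [Mi|Mi] := ring_div_total fi0 fi00 Ui.
- exists i0; split; first by rewrite inE i0s orbT.
    by move=> j; rewrite inE => /orP[/eqP->//|]; exact: Mi0.
  by rewrite big_cons mulrDl addrC; exact: unitD.
- have eqi0 a : a / f i = (a / f i0) * (f i0 / f i).
    by rewrite mulrA mulfVK.
  exists i; split; first exact: mem_head.
    move=> j; rewrite inE => /orP[->//|js] _; rewrite eqi0; apply: idealMl => //.
    have [->|/(Mi0 _ js)/ideal_ring //] := eqVneq j i0.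
    by rewrite divff //; exact: ring1.
  rewrite big_cons mulrDl divff //; apply: unitD; first exact: unit1.
  by rewrite eqi0; apply: idealMl => //; exact: unit_ring.
Qed.

(** An integral equation has the form [z ^+ n = - sum_i c_i * z ^+ i] with the [c_i]
    in the ring and [i < n]; if [z] had a pole, dividing by [z ^+ n] would put 1
    in the ideal. *)
Lemma integral_ring (A : nzRingType) (f : {rmorphism A -> F}) z :
  (forall c, O (f c)) -> integralOver f z -> O z.
Proof.
move=> Of [q q_monic qz]; have [//|nOz] := EM (O z).
have z0 : z != 0 by apply: contra_notN nOz => /eqP->; exact: ring0.
have Mzi := not_ring_inv nOz.
have: root (map_poly f q) z by [].
rewrite /root horner_coef size_map_poly_id0; last first.
  by rewrite (monicP q_monic) rmorph1 oner_eq0.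
have qS : size q = (size q).-1.+1 by rewrite prednK // size_poly_gt0 monic_neq0.
rewrite qS big_ord_recr /= coef_map -lead_coefE (monicP q_monic) /=.
rewrite (rmorph1 f) mul1r.
set n := (size q).-1; rewrite addr_eq0 => /eqP eqz.
have /unitV : U (-1) by split; rewrite ?oppr_eq0 ?oner_eq0 ?invrN1 //; exact/ringN/ring1.
rewrite invrN1 => UN1; case: (ideal_unit _ UN1).
have -> : -1 = (\sum_(i < n) (map_poly f q)`_i * z ^+ i) / z ^+ n.
  by rewrite eqz mulNr divff // expf_neq0.
rewrite mulr_suml; apply: ideal_sum => i _.
rewrite coef_map -mulrA; apply: idealMl; first exact: Of.
rewrite -[X in _ / z ^+ X](subnK (ltnW (ltn_ord i))) exprD invfM mulrCA.
rewrite divff ?expf_neq0 // mulr1.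
by rewrite -exprVn; apply: idealX => //; rewrite subn_gt0.
Qed.

End PlaceTheory.
(** * Discrete places *)

Section Discrete.
Variables (K F : fieldType) (k : {rmorphism K -> F}) (P : place k).
Implicit Types (a b z u t : F).

Local Notation O := (place_ring P).
Local Notation M := (place_ideal P).
Local Notation U := (place_unit P).

Lemma prime_element_ideal t : prime_element P t -> M t.
Proof. by move=> ->; exists 1; rewrite ?mulr1 //; exact: ring1. Qed.

Lemma prime_element_neq0 t : prime_element P t -> t != 0.
Proof.
move=> tP; have [z nOz] := ring_proper P.
have [u _ Ezi] : [set t * u | u in O] z^-1 by rewrite -tP; exact: not_ring_inv.
apply: contra_notN nOz => /eqP t0; move: Ezi; rewrite t0 mul0r => /esym/eqP.
by rewrite invr_eq0 => /eqP->; exact: ring0.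
Qed.

Lemma unit_exprz t (n : int) : M t -> t != 0 -> U (t ^ n) -> n = 0.
Proof.
move=> Mt t0; case: n => [[//|n]|n /unitV].
  by move=> /(ideal_unit (idealX (ltn0Sn n) Mt)).
by rewrite NegzE -invr_expz invrK => /(ideal_unit (idealX (ltn0Sn n) Mt)).
Qed.

Lemma valuation_unique t t' u u' (n n' : int) :
    prime_element P t -> prime_element P t' -> U u -> U u' ->
  t ^ n * u = t' ^ n' * u' -> n = n'.
Proof.
move=> tP t'P Uu Uu' eq_n.
have [t0 t'0] := (prime_element_neq0 tP, prime_element_neq0 t'P).
have [v Ov Et] : [set t' * v | v in O] t by rewrite -t'P; exact: prime_element_ideal.
have [v' Ov' Et'] : [set t * v | v in O] t' by rewrite -tP; exact: prime_element_ideal.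
have vv' : v * v' = 1 by apply: (mulfI t'0); rewrite mulrA Et Et' mulr1.
have Uv : U v.
  have v0 : v != 0 by apply: contraNneq t0 => v0; rewrite -Et v0 mulr0.
  by split=> //; rewrite -[v^-1]mulr1 -vv' mulKf.
apply/eqP; rewrite -subr_eq0; apply/eqP.
apply: (unit_exprz (prime_element_ideal t'P) t'0).
have -> : t' ^ (n - n') = u' / (v ^ n * u).
  rewrite expfzDr // -invr_expz; apply: (mulIf (expfz_neq0 n' t'0)).
  have tn0 : v ^ n * u != 0.
    by rewrite mulf_neq0 ?expfz_neq0 ?(unit_neq0 Uu) ?(unit_neq0 Uv).
  rewrite mulfVK ?expfz_neq0 //; apply: (mulIf tn0).
  by rewrite mulrA -expfzMl Et eq_n mulrAC mulfVK // mulrC.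
apply: unitM => //; apply/unitV/unitM => //; exact: unitXz.
Qed.

Lemma valuationE t u (n : int) : prime_element P t -> U u -> valuation P (t ^ n * u) = n.
Proof.
move=> tP Uu; rewrite /valuation; case: xgetP => [n' _ [t' [u' [t'P Uu' e]]]|no].
  by apply/esym; exact: valuation_unique e.
by case: (no n); exists t, u.
Qed.

Lemma valuation0 : valuation P 0 = 0.
Proof.
rewrite /valuation; case: xgetP => [n _ [t [u [tP Uu /esym/eqP]]]|//].
by rewrite mulf_eq0 expfz_eq0 (negPf (prime_element_neq0 tP)) andbF
           (negPf (unit_neq0 Uu)).
Qed.

(** An element of the ring admits no negative exponent, and the value taken when no
    exponent is admissible is nonnegative too. *)
Lemma valuation_ge0 z : O z -> 0 <= valuation P z.
Proof.
rewrite /valuation; case: xgetP => [[//|n] _ [t [u [tP Uu Ez]]] Oz|//].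
have t0 := prime_element_neq0 tP.
have /ideal_not_inv : M (t ^+ n.+1) by apply/idealX/prime_element_ideal.
rewrite expf_neq0 // => /(_ isT); case.
have -> : (t ^+ n.+1)^-1 = z / u by rewrite Ez mulfK // (unit_neq0 Uu).
by apply/ringM/unit_ring/unitV.
Qed.

Lemma valuation_gt0_ideal z : 0 < valuation P z -> M z.
Proof.
rewrite /valuation; case: xgetP => [[[//|n]|//] _ [t [u [tP Uu ->]]] _|//].
by apply/idealMr/unit_ring => //; apply/idealX/prime_element_ideal.
Qed.

Lemma prime_elementI t : M t ->
    (forall z, z != 0 -> exists n : int, exists2 u, U u & z = t ^ n * u) ->
  prime_element P t.
Proof.
move=> Mt tgen; apply/seteqP; split=> [z Mz|_ [u Ou <-]]; last exact: idealMr.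
have [->|z0] := eqVneq z 0; first by exists 0; rewrite ?mulr0 //; exact: ring0.
have [[[|n]|n] [u Uu Ez]] := tgen z z0.
- by move: Mz; rewrite Ez mul1r => /ideal_unit.
- exists (t ^+ n * u); last by rewrite mulrA -exprS.
  by apply/ringM/unit_ring => //; apply/ringX/ideal_ring.
- case: (ideal_not_inv Mz z0); rewrite Ez NegzE -invr_expz invfM invrK.
  by apply/ringM/unit_ring/unitV => //; apply/ringX/ideal_ring.
Qed.

Lemma valuation_lt0 t z :
    prime_element P t -> (exists n : int, exists2 u, U u & z = t ^ n * u) ->
  ~ O z -> valuation P z < 0.
Proof.
move=> tP [n [u Uu Ez]] nOz; rewrite Ez valuationE //.
case: n Ez => // n Ez; case: nOz; rewrite Ez.
by apply/ringM/unit_ring => //; apply/ringX/ideal_ring/prime_element_ideal.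
Qed.

(** If some fixed power of every element has the value of a power of [pi], then
    the values embed into the integers, and a nonunit of least positive value is
    a prime element. *)
Lemma discrete_of_bounded_exponent pi e : M pi -> pi != 0 -> (0 < e)%N ->
    (forall z, z != 0 -> exists n : int, exists2 u, U u & z ^+ e = pi ^ n * u) ->
  exists2 t, prime_element P t
    & forall z, z != 0 -> exists n : int, exists2 u, U u & z = t ^ n * u.
Proof.
move=> Mpi pi0 e0 pigen.
pose has_value z (n : int) := z != 0 /\ U (z ^+ e / pi ^ n).
have value_ex z : z != 0 -> exists n, has_value z n.
  move=> z0; have [n [u Uu Ez]] := pigen z z0; exists n; split=> //.
  by rewrite Ez mulrAC divff ?mul1r // expfz_neq0.
have pin0 n : pi ^ n != 0 by rewrite expfz_neq0.
have ring_value z n : has_value z n -> 0 <= n -> O z.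
  case: n => // n [z0 Uz] _; apply: (ring_expn e0).
  rewrite -[z ^+ e](mulfVK (pin0 n)); apply/ringM; first exact: unit_ring.
  exact/ringX/ideal_ring.
have unit_value z : has_value z 0 -> U z.
  by move=> [_ Uz]; apply: (unit_expn e0); rewrite -[z ^+ e]divr1 -(expr0z pi).
have value_div z z' n n' (d : int) :
    has_value z n -> has_value z' n' -> has_value (z / z' ^ d) (n - n' * d).
  move=> [z0 Uz] [z'0 Uz']; split; first by rewrite mulf_neq0 ?invr_eq0 ?expfz_neq0.
  have -> : (z / z' ^ d) ^+ e / pi ^ (n - n' * d) =
            (z ^+ e / pi ^ n) / (z' ^+ e / pi ^ n') ^ d.
    have -> : (z / z' ^ d) ^+ e = z ^+ e / (z' ^+ e) ^ d.
      by rewrite exprMn exprVn; congr (_ / _); exact: (exprzAC z' d e).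
    rewrite expfzDr // -invr_expz -exprz_exp expfzMl exprz_inv -invr_expz.
    by rewrite !invfM !invrK mulrACA.
  by apply/unitM/unitV/unitXz.
have Mvalue z n : has_value z n -> 0 < n -> M z.
  move=> zn n0; apply/idealE; split; first exact: ring_value zn (ltW n0).
  move=> /(unitX e) Uz; case: zn => z0 /unitV/(unitM Uz).
  rewrite invf_div mulrA mulrAC divff ?expf_neq0 // mul1r => /unit_exprz.
  by move=> /(_ Mpi pi0) n00; rewrite n00 ltxx in n0.
(* The value of [z] is the [n] with [z ^+ e] equal to [pi ^ n] up to a unit, so that
   [pi] has value [e]. *)
have pospi : exists n : nat, `[< (0 < n)%N /\ exists z, has_value z n%:Z >].
  exists e; apply/asboolP; split=> //; exists pi; split=> //.
  by rewrite divff ?expf_neq0 //; exact: unit1.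
case: (ex_minnP pospi) => n /asboolP[n0 [t tn]] nmin.
have gen z : z != 0 -> exists q : int, exists2 u, U u & z = t ^ q * u.
  move=> z0; have [s zs] := value_ex z z0; exists (s %/ n%:Z)%Z.
  have tq0 : t ^ (s %/ n%:Z)%Z != 0 by rewrite expfz_neq0 //; case: tn.
  exists (z / t ^ (s %/ n%:Z)%Z); last by rewrite mulrC mulfVK.
  have := value_div _ _ _ _ (s %/ n%:Z)%Z zs tn.
  have -> : s - n%:Z * (s %/ n%:Z)%Z = (s %% n%:Z)%Z.
    by rewrite mulrC {1}(divz_eq s n%:Z) addrC addKr.
  have: (s %% n%:Z)%Z < n%:Z by rewrite ltz_pmod.
  have: 0 <= (s %% n%:Z)%Z by rewrite modz_ge0 // eqz_nat -lt0n.
  case: (s %% n%:Z)%Z => // -[_ _|d _]; first exact: unit_value.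
  rewrite ltz_nat => dn dval; have: (n <= d.+1)%N.
    by apply: nmin; apply/asboolP; split=> //; exists (z / t ^ (s %/ n%:Z)%Z).
  by rewrite leqNgt dn.
exists t => //; apply: prime_elementI => //; exact: Mvalue tn _.
Qed.

End Discrete.
(** * Existence of places *)

Section PlaceExistence.
Variables (K F : fieldType) (k : {rmorphism K -> F}).
Implicit Types (B : set F) (z u : F) (q : {poly F}).

Lemma proper_witness (T : Type) (X Y : set T) x : X `<=` Y -> Y x -> ~ X x -> X `<` Y.
Proof. by move=> XY Yx nXx; split=> // /(_ _ Yx). Qed.

Definition adjoin B u : set F := [set q.[u] | q in [set q : {poly F} | forall i, B q`_i]].

Lemma adjoin_subring B u : subring B -> subring (adjoin B u).
Proof.
move=> sB; have [B1 BB BM] := sB; split.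
- exists 1; last by rewrite hornerC.
  by move=> i; rewrite coef1; case: (i == 0)%N => //; exact: subring0.
- move=> _ _ [q Bq <-] [q' Bq' <-]; exists (q - q'); last by rewrite !hornerE.
  by move=> i; rewrite coefB; exact: BB.
- move=> _ _ [q Bq <-] [q' Bq' <-]; exists (q * q'); last by rewrite hornerM.
  by move=> i; rewrite coefM; apply: subring_sum => // j _; exact: BM.
Qed.

Lemma adjoin_sub B u : subring B -> B `<=` adjoin B u.
Proof.
move=> sB a Ba; exists a%:P; last by rewrite hornerC.
by move=> i; rewrite coefC; case: (i == 0)%N => //; exact: subring0.
Qed.

Lemma adjoin_gen B u : subring B -> adjoin B u u.
Proof.
move=> sB; have [B1 _ _] := sB; exists 'X; last by rewrite hornerX.
by move=> i; rewrite coefX; case: (i == 1)%N => //; exact: subring0.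
Qed.

Lemma sum_rev_horner q n u : u != 0 -> (size q <= n.+1)%N ->
  \sum_(i < n.+1) q`_(n - i) * u ^+ i = u ^+ n * q.[u^-1].
Proof.
move=> u0 szq; rewrite (horner_coef_wide _ szq) mulr_sumr (reindex_inj rev_ord_inj).
apply: eq_bigr => i _ /=; have le_in : (i <= n)%N by rewrite -ltnS.
rewrite subSS subKn // mulrCA; congr (_ * _).
by rewrite exprVn -[X in _ = u ^+ X / _](subnK le_in) exprD mulfK // expf_neq0.
Qed.

(** Two relations for [z], of degree [n] in [u] and [n' <= n] in the inverse of
    [u], combine into one of smaller degree in [u]: the second, multiplied by
    [a * u ^+ n / z] with [a] the leading coefficient of the first, expresses
    [(1 - q'`_0 / z) * a * u ^+ n] by lower powers of [u], which removes the leading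
    term from the multiple of the first by [1 - q'`_0 / z]. *)
Lemma adjoin_inv_inter B z u : subring B -> z != 0 -> B z^-1 -> u != 0 ->
  adjoin B u z -> adjoin B u^-1 z -> B z.
Proof.
move=> sB z0 Bzi u0 [q Bq zq] [q' Bq' zq'].
move: {2}(size q + size q')%N (leqnn (size q + size q')) => N.
elim: N u u0 q q' Bq Bq' zq zq' => [|N IH] u u0 q q' Bq Bq' zq zq' leN.
  move: z0; rewrite -zq; suff /eqP -> : q == 0 by rewrite horner0 eqxx.
  by rewrite -size_poly_eq0; move: leN; rewrite leqn0 addn_eq0 => /andP[].
wlog le_q'q : u u0 q q' Bq Bq' zq zq' leN / (size q' <= size q)%N.
  move=> wl; have [/wl h|/ltnW le_qq'] := leqP (size q') (size q).
    exact: h zq zq' _.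
  apply: (wl u^-1 _ q' q); rewrite ?invr_eq0 ?invrK //.
  by rewrite addnC.
have [sz1|] := leqP (size q) 1.
  by rewrite -zq (size1_polyC sz1) hornerC.
case szq : (size q) => [//|n] n0; rewrite szq in le_q'q leN.
have [B1 BB BM] := sB.
have {}Bq : forall i, B q`_i := Bq; have {}Bq' : forall i, B q'`_i := Bq'.
pose a := q`_n; pose b := q'`_0; pose s : F := 1 - b / z.
pose c i := (if i == 0%N then b else 0) + s * q`_i + a / z * q'`_(n - i).
have Bs : B s by apply: (BB) => //; exact: BM (Bq' 0) Bzi.
apply: (IH u u0 (\poly_(i < n) c i) q') => //; last 1 first.
- by rewrite (leq_trans _ (_ : n + size q' <= N)%N) ?leq_add2r ?size_poly // -ltnS.
- move=> i; rewrite coef_poly; case: ifP => _; last exact: subring0.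
  apply: subringD => //; last by apply: (BM) => //; exact: BM (Bq n) Bzi.
  apply: subringD => //; last exact: BM Bs (Bq i).
  by case: ifP => _; [exact: Bq' | exact: subring0].
have Eq : \sum_(i < n) q`_i * u ^+ i = z - a * u ^+ n.
  by rewrite -zq horner_coef szq big_ord_recr /= addrK.
have Eq' : \sum_(i < n) q'`_(n - i) * u ^+ i = u ^+ n * z - b * u ^+ n.
  rewrite -zq' -(sum_rev_horner u0 le_q'q) big_ord_recr /= subnn -/b.
  by rewrite addrK.
rewrite horner_poly; under eq_bigr => i _ do rewrite !mulrDl -!mulrA.
rewrite !big_split /= -!mulr_sumr Eq Eq'.
have -> : \sum_(i < n) (if i == 0%N :> nat then b else 0) * u ^+ i = b.
  case: (n) n0 => // n' _; rewrite big_ord_recl /= expr0 mulr1 big1 ?addr0 // => i _.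
  by rewrite mul0r.
by rewrite /s; field.
Qed.

(** If [z] lay in [A[z^-1]], multiplying by a power of [z] would give an integral
    equation. So Zorn's lemma yields a subring that is maximal among those that
    contain [A[z^-1]] but not [z]. Adjoining an element outside it brings [z] in, and
    by [adjoin_inv_inter] this cannot happen for both [u] and its inverse: the
    subring is a valuation ring. *)
Lemma exists_place (A : comNzRingType) (f : {rmorphism A -> F}) z :
    (forall c, exists a, k c = f a) -> ~ integralOver f z ->
  exists P : place k, (forall a, place_ring P (f a)) /\ ~ place_ring P z.
Proof.
move=> kf nint; have z0 : z != 0.
  by apply: contra_notN nint => /eqP->; exact: integral0.
pose good B := [/\ subring B, range f `<=` B, B z^-1 & ~ B z].
have srf : subring (range f).
  split; first by exists 1; rewrite ?rmorph1.
    by move=> _ _ [a _ <-] [b _ <-]; exists (a - b); rewrite ?rmorphB.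
  by move=> _ _ [a _ <-] [b _ <-]; exists (a * b); rewrite ?rmorphM.
have good0 : good (adjoin (range f) z^-1).
  split; [exact: adjoin_subring|exact: adjoin_sub|exact: adjoin_gen|].
  case=> q fq zq; apply: nint; pose n := size q.
  pose g := \poly_(i < n.+1) q`_(n - i).
  have intg i : integralOver f g`_i.
    rewrite coef_poly; case: ifP => _; last exact: integral0.
    by have [a _ <-] := fq (n - i)%N; exact: integral_id.
  apply: (@integral_root_monic A F f z ('X^(n.+1) - g)).
  - rewrite monicE lead_coefDl ?lead_coefXn // size_polyN size_polyXn ltnS.
    exact: size_poly.
  - rewrite rootE !hornerE horner_poly (sum_rev_horner z0 (leqnSn _)) zq.
    by rewrite -exprSr subrr.
  - apply/integral_poly => i; rewrite coefB coefXn; apply: integral_sub => //.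
    exact: integral_nat.
have [C [goodC Cmax]] : exists C, (C = set0 \/ good C) /\
    forall B, C `<` B -> ~ (B = set0 \/ good B).
  (* [set0] is allowed only to accommodate the union of the empty chain. *)
  apply: Zorn_bigcup => Fam Famgood Famtot.
  have [[B0 FB0 gB0]|nogood] := EM (exists2 B, Fam B & good B); last first.
    left; apply/seteqP; split=> // x [B FB Bx]; case: nogood; exists B => //.
    by have [B0|//] := Famgood _ FB; rewrite B0 in Bx.
  have good_mem B x : Fam B -> B x -> good B.
    by move=> /Famgood[->|].
  have two a b : (\bigcup_(X in Fam) X) a -> (\bigcup_(X in Fam) X) b ->
      exists B, [/\ Fam B, good B, B a & B b].
    move=> [B FB Ba] [B' FB' B'b]; have [BB'|B'B] := Famtot _ _ FB FB'.
      by exists B'; split=> //; [exact: good_mem B'b | exact: BB'].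
    by exists B; split=> //; [exact: good_mem Ba | exact: B'B].
  right; have [sB0 fB0 B0zi _] := gB0; split.
  - split; first by exists B0 => //; have [] := sB0.
      move=> a b Ua Ub; have [B [FB [[_ BB _] _ _ _] Ba Bb]] := two _ _ Ua Ub.
      by exists B => //; exact: BB.
    move=> a b Ua Ub; have [B [FB [[_ _ BM] _ _ _] Ba Bb]] := two _ _ Ua Ub.
    by exists B => //; exact: BM.
  - by move=> a /fB0 B0a; exists B0.
  - by exists B0.
  - by case=> B FB Bz; have [_ _ _ /(_ Bz)] := good_mem _ _ FB Bz.
have {}goodC : good C.
  case: goodC => // C0; case: (Cmax (adjoin (range f) z^-1)); last by right.
  by rewrite C0; apply: (@proper_witness _ _ _ z^-1) => //; case: good0.
have [sC fC Czi nCz] := goodC.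
have kC c : C (k c) by have [a ->] := kf c; apply: fC; exists a.
have inC u : ~ C u -> adjoin C u z.
  move=> nCu; have [//|nz] := EM (adjoin C u z); case: (Cmax (adjoin C u)).
    exact: proper_witness (adjoin_sub u sC) (adjoin_gen u sC) nCu.
  right; split=> //; first exact: adjoin_subring.
    by move=> a /fC; exact: adjoin_sub.
  exact: adjoin_sub.
have Cval : valuation_ring k C.
  split.
  - exact/subring_closedP.
  - apply: (@proper_witness _ _ _ z^-1) => // [_ [c _ <-] //|[c _ kc]]; apply: nCz.
    by rewrite -[z]invrK -kc -fmorphV.
  - exact: (@proper_witness _ _ _ z).
  - move=> u; have [->|u0] := eqVneq u 0; first by left; exact: subring0.
    apply: contrapT => /not_orP[nCu nCui]; apply: nCz.
    exact: adjoin_inv_inter (inC _ nCu) (inC _ nCui).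
by exists (Place Cval (nonunits_maximal Cval)); split=> // a; apply: fC; exists a.
Qed.

End PlaceExistence.
(** * Places at finite distance *)

Section RationalField.
Variables (K : closedFieldType) (E : fieldType) (k0 : {rmorphism K -> E}) (w : E).

Definition poly_in : {rmorphism {poly K} -> E} :=
  horner_morph (fun c => mulrC w (k0 c)).

(** [E] is the field K(w). *)
Definition generates : Prop :=
  forall h : E, exists a b : {poly K}, poly_in b != 0 /\ h = poly_in a / poly_in b.

Lemma poly_inC c : poly_in c%:P = k0 c.
Proof. exact: horner_morphC. Qed.

Lemma poly_inX : poly_in 'X = w.
Proof. exact: horner_morphX. Qed.

End RationalField.

Section ScalarEmbedding.
Variables (E : fieldType) (F : fieldExtType E).
Implicit Types a b : E.

Lemma scalar0 : 0%:A = 0 :> F. Proof. exact: (rmorph0 (in_alg F)). Qed.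
Lemma scalar1 : 1%:A = 1 :> F. Proof. exact: (rmorph1 (in_alg F)). Qed.
Lemma scalarD a b : (a + b)%:A = a%:A + b%:A :> F.
Proof. exact: (rmorphD (in_alg F)). Qed.
Lemma scalarM a b : (a * b)%:A = a%:A * b%:A :> F.
Proof. exact: (rmorphM (in_alg F)). Qed.
Lemma scalarX a n : (a ^+ n)%:A = a%:A ^+ n :> F.
Proof. exact: (rmorphXn (in_alg F)). Qed.
Lemma scalarV a : (a^-1)%:A = a%:A^-1 :> F.
Proof. exact: (fmorphV (in_alg F)). Qed.
Lemma scalar_eq0 a : (a%:A == 0 :> F) = (a == 0).
Proof. exact: (fmorph_eq0 (in_alg F)). Qed.
Lemma scalar_inj : injective (fun a => a%:A : F).
Proof. exact: (fmorph_inj (in_alg F)). Qed.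
Lemma scalar_sum (I : Type) (s : seq I) (f : I -> E) :
  (\sum_(i <- s) f i)%:A = \sum_(i <- s) (f i)%:A :> F.
Proof. exact: (rmorph_sum (in_alg F)). Qed.
Lemma scalar_prod (I : Type) (s : seq I) (f : I -> E) :
  (\prod_(i <- s) f i)%:A = \prod_(i <- s) (f i)%:A :> F.
Proof. exact: (rmorph_prod (in_alg F)). Qed.

End ScalarEmbedding.

Section FinitePlace.
Variables (K : closedFieldType) (E : fieldType) (k0 : {rmorphism K -> E}) (w : E).
Variables (F : fieldExtType E) (P : place (in_alg F \o k0)).
Local Notation phi := (poly_in k0 w).
Local Notation O := (place_ring P).
Local Notation M := (place_ideal P).
Local Notation U := (place_unit P).
Hypotheses (wgen : generates k0 w) (phi_inj : injective phi) (Ow : O w%:A).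

Lemma ring_poly_in a : O (phi a)%:A.
Proof.
elim/poly_ind: a => [|a c IH]; first by rewrite rmorph0 scalar0; exact: ring0.
rewrite rmorphD rmorphM /= horner_morphX horner_morphC scalarD scalarM.
by apply: ringD; [exact: ringM | exact: (ring_const P c)].
Qed.

Lemma unit_poly_in_of_linear :
  (forall c, U (phi ('X - c%:P))%:A) -> forall a, a != 0 -> U (phi a)%:A.
Proof.
move=> Ulin a a0; have [s Ea] := closed_field_poly_normal a.
rewrite Ea -mul_polyC rmorphM rmorph_prod /= horner_morphC scalarM scalar_prod.
apply: unitM; first by apply: (unit_const P); rewrite lead_coef_eq0.
apply: big_ind => [||d _]; [exact: unit1 | exact: unitM | exact: Ulin].
Qed.

(** If all the [w - c] were units, every nonzero polynomial in [w] would be one, as [K]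
    is algebraically closed. Then [E] would lie in the valuation ring, and so would
    [F], being integral over [E]. *)
Lemma exists_center : exists c, M (phi ('X - c%:P))%:A.
Proof.
apply: contrapT => /forallNP nM.
have Upoly := unit_poly_in_of_linear (fun c =>
  match ideal_or_unit (ring_poly_in ('X - c%:P)) with
  | or_introl Mc => False_ind _ (nM c Mc) | or_intror Uc => Uc end).
have [z nOz] := ring_proper P; apply: nOz.
apply: (@integral_ring _ _ _ P E (in_alg F)).
  move=> h; have [a [b [b0 ->]]] := wgen h.
  rewrite /= scalarM scalarV; apply: ringM; first exact: ring_poly_in.
  by apply/unit_ring/unitV/Upoly; apply: contra_neq b0 => ->; rewrite rmorph0.
have /polyOver1P[p Ep] := minPolyOver 1 z.
exists p; first by rewrite -(map_monic (in_alg F)) -Ep monic_minPoly.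
by rewrite -Ep root_minPoly.
Qed.

Section Center.
Variable c : K.
Hypothesis Mc : M (phi ('X - c%:P))%:A.
Local Notation pi := ((phi ('X - c%:P))%:A : F).

Lemma center_neq0 : pi != 0.
Proof. by rewrite scalar_eq0 raddf_eq0 // polyXsubC_eq0. Qed.

Lemma unit_poly_in a : ~~ root a c -> U (phi a)%:A.
Proof.
move=> ac; have /factor_theorem[b Eb] : root (a - a.[c]%:P) c.
  by rewrite /root !hornerE subrr.
rewrite -[a](subrK a.[c]%:P) Eb addrC !rmorphD rmorphM /= horner_morphC scalarD scalarM.
apply: unitD; first exact: (unit_const P).
by apply: idealMl => //; exact: ring_poly_in.
Qed.

Lemma center_value_poly a : a != 0 ->
  exists n : nat, exists2 u, U u & (phi a)%:A = pi ^+ n * u.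
Proof.
move=> a0; have [n [q]] := multiplicity_XsubC a c; rewrite a0 /= => qc ->.
exists n, (phi q)%:A; first exact: unit_poly_in.
by rewrite rmorphM rmorphXn scalarM scalarX mulrC.
Qed.

Lemma center_value h : h != 0 ->
  exists n : int, exists2 u, U u & h%:A = pi ^ n * u.
Proof.
have [a [b [b0 ->]]] := wgen h; rewrite mulf_eq0 negb_or => /andP[a0 _].
have [n [u Uu En]] := center_value_poly (contra_neq (fun e : a = 0 =>
  etrans (congr1 phi e) (rmorph0 phi)) a0).
have [n' [u' Uu' En']] := center_value_poly (contra_neq (fun e : b = 0 =>
  etrans (congr1 phi e) (rmorph0 phi)) b0).
exists (n%:Z - n'%:Z), (u / u'); first by apply/unitM/unitV.
rewrite scalarM scalarV En En' expfzDr ?center_neq0 // -invr_expz invfM.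
by rewrite mulrACA.
Qed.

(** Two terms of an algebraic equation for [z] over [E] must have the same value;
    this determines the value of a power of [z], with exponent at most the degree
    of the extension. *)
Lemma center_value_pow z : z != 0 ->
  exists n : int, exists2 u, U u & z ^+ (\dim {:F})`! = pi ^ n * u.
Proof.
move=> z0; have /polyOver1P[p Ep] := minPolyOver 1 z.
have p0 : p != 0 by rewrite -(map_poly_eq0 (in_alg F)) -Ep monic_neq0 ?monic_minPoly.
have szp : ((size p).-1 <= \dim {:F})%N.
  rewrite -(size_map_poly (in_alg F)) -Ep size_minPoly adjoin_degreeE dimv1 divn1.
  exact/dimvS/subvf.
have pz : (map_poly (in_alg F) p).[z] = 0 by rewrite -Ep minPolyxx.
pose s := [seq i <- iota 0 (size p) | p`_i != 0].
pose f i := (p`_i)%:A * z ^+ i.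
have f0 i : i \in s -> f i != 0.
  by rewrite mem_filter => /andP[pi0 _]; rewrite mulf_neq0 ?expf_neq0 // scalar_eq0.
have sumf : \sum_(i <- s) f i = 0.
  rewrite -[RHS]pz horner_coef size_map_poly big_filter big_mkcond /=.
  rewrite -(big_mkord xpredT (fun i => (map_poly (in_alg F) p)`_i * z ^+ i)).
  rewrite /index_iota subn0; apply: eq_bigr => i _.
  by rewrite coef_map /=; case: eqVneq => //= ->; rewrite scalar0 mul0r.
have s0 : s != [::].
  apply/eqP => s0; have : (size p).-1 \in s.
    rewrite mem_filter /= -lead_coefE lead_coef_eq0 p0 mem_iota add0n /=.
    by rewrite prednK ?size_poly_gt0.
  by rewrite s0.
have [i [j [si sj ltij Uij]]] :
    exists i j, [/\ i \in s, j \in s, (i < j)%N & U (f j / f i)].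
  apply: contrapT => no.
  have us : uniq s by rewrite filter_uniq ?iota_uniq.
  have sU i j : i \in s -> j \in s -> i != j -> ~ U (f i / f j).
    move=> si sj; rewrite neq_ltn => /orP[ij|ji] Uij; apply: no.
      by exists i, j; split=> //; rewrite -invf_div; exact: unitV.
    by exists j, i.
  have [i [_ _]] := sum_unit us s0 f0 sU.
  by rewrite sumf mul0r => /unit_neq0; rewrite eqxx.
have [n [u Uu Eu]] : exists n : int, exists2 u, U u & z ^+ (j - i) = pi ^ n * u.
  have pi0 : p`_i / p`_j != 0.
    move: si sj; rewrite !mem_filter => /andP[? _] /andP[? _].
    by rewrite mulf_neq0 ?invr_eq0.
  have [n [u Uu Eu]] := center_value pi0.
  exists n, (u * (f j / f i)); first exact: unitM.
  have [fi0 fj0] := (f0 _ si, f0 _ sj).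
  rewrite mulrA -Eu /f scalarM scalarV !invfM.
  move: fi0 fj0; rewrite !mulf_eq0 !negb_or => /andP[pi0' zi0] /andP[pj0 _].
  have -> : z ^+ j = z ^+ (j - i) * z ^+ i by rewrite -exprD subnK // ltnW.
  by field; rewrite pi0' pj0 zi0.
have dle : (j - i <= \dim {:F})%N.
  apply: leq_trans szp; move: sj; rewrite mem_filter mem_iota => /andP[_ /andP[_]].
  rewrite add0n => ltj; rewrite (leq_trans (leq_subr _ _)) // -ltnS prednK //.
  exact: leq_ltn_trans ltj.
have /dvdnP[q Eq] : (j - i %| (\dim {:F})`!)%N by rewrite dvdn_fact // subn_gt0 ltij.
exists (n * q), (u ^+ q); first exact: unitX.
by rewrite Eq mulnC exprM Eu exprMn -exprz_exp.
Qed.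

End Center.

Lemma finite_place_discrete : exists2 t, prime_element P t &
  forall z, z != 0 -> exists n : int, exists2 u, U u & z = t ^ n * u.
Proof.
have [c Mc] := exists_center.
apply: (discrete_of_bounded_exponent Mc (center_neq0 c) (fact_gt0 (\dim {:F}))).
by move=> z; exact: center_value_pow.
Qed.

Lemma valuation_lt0_finite z : ~ O z -> valuation P z < 0.
Proof.
have [t tP tgen] := finite_place_discrete.
move=> nOz; apply: (valuation_lt0 tP _ nOz); apply: tgen.
by apply: contra_notN nOz => /eqP->; exact: ring0.
Qed.

End FinitePlace.
(** * The totally ramified pole of the generator *)

(** The pole orders of [h * Y ^+ i] and [h' * Y ^+ j], for [h] and [h'] in the base
    field, agree only if [i = j]. *)
Lemma order_residue_inj (m D i j : nat) (x x' : int) :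
    coprime m D -> (i < m)%N -> (j < m)%N ->
  m%:Z * x + (i * D)%:Z = m%:Z * x' + (j * D)%:Z -> i = j.
Proof.
move=> mD; wlog le_ij : i j x x' / (i <= j)%N => [wl im jm eq_ij|im jm eq_ij].
  have [ij|/ltnW ji] := leqP i j; first exact: wl eq_ij.
  exact/esym/(wl j i x' x).
have : (m %| (j - i) * D)%N.
  have : (m%:Z %| ((j - i) * D)%N%:Z)%Z.
    apply/dvdzP; exists (x - x'); rewrite mulnBl -subzn ?leq_mul2r ?le_ij ?orbT //.
    have -> : (j * D)%N%:Z = m%:Z * x + (i * D)%N%:Z - m%:Z * x'.
      by rewrite eq_ij addrAC subrr add0r.
    by ring.
  by rewrite dvdzE !absz_nat.
rewrite Gauss_dvdl // => /dvdnP[q Eq].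
apply/eqP; rewrite eqn_leq le_ij /= -subn_eq0 Eq; case: q Eq => // q Eq.
have : (m <= j - i)%N by rewrite Eq mulSn leq_addr.
by rewrite leqNgt (leq_ltn_trans (leq_subr _ _) jm).
Qed.

Section RamifiedPlace.
Variables (K : closedFieldType) (E : fieldType) (k0 : {rmorphism K -> E}) (w : E).
Variables (F : fieldExtType E) (m : nat) (G : {poly K}) (Y : F).
Local Notation phi := (poly_in k0 w).
Local Notation deg a := (size (a : {poly K})).-1.
Local Notation D := (deg G).
Hypotheses (m0 : (0 < m)%N) (G0 : G != 0) (mD : coprime m D).
Hypotheses (Ycurve : Y ^+ m = (phi G)%:A) (wgen : generates k0 w).

(** By Bezout this element has value 1 at a place where [w] has value [- m] and
    [Y] has value [- D]. *)
Definition uniformizer : F := Y ^+ (egcdn m D).2 / w%:A ^+ (egcdn m D).1.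
Local Notation t := uniformizer.

Section OnePlace.
Variables (P : place (in_alg F \o k0)).
Local Notation O := (place_ring P).
Local Notation M := (place_ideal P).
Local Notation U := (place_unit P).
Hypothesis (nOw : ~ O w%:A).

Lemma pole_neq0 : w%:A != 0 :> F.
Proof. by apply: contra_notN nOw => /eqP->; exact: ring0. Qed.

Lemma poly_value a : a != 0 -> exists2 u, U u & (phi a)%:A = w%:A ^+ deg a * u.
Proof.
have W0 := pole_neq0.
elim/poly_ind: a => [|a c IH]; first by rewrite eqxx.
rewrite rmorphD rmorphM /= horner_morphX horner_morphC scalarD scalarM size_MXaddC.
have [-> ac0|a0 _] := eqVneq a 0; last first.
  have [u Uu ->] := IH a0; have szE : size a = (deg a).+1.
    by rewrite prednK ?size_poly_gt0.
  exists (u + (k0 c)%:A * w%:A^-1 ^+ (deg a).+1).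
    apply: unitD => //; apply: idealMl; first exact: (ring_const P).
    by apply: idealX => //; exact: not_ring_inv.
  rewrite /= szE /= mulrDr mulrCA -exprMn divff // expr1n mulr1.
  by rewrite exprSr mulrAC.
have c0 : c != 0 by apply: contra_neq ac0 => ->; rewrite mul0r add0r.
exists (k0 c)%:A; first exact: (unit_const P).
by rewrite rmorph0 scalar0 mul0r add0r (negPf c0) size_poly0 mul1r.
Qed.

Lemma pole_poly_in_inj : injective phi.
Proof.
move=> a b eq_ab; apply/eqP; rewrite -subr_eq0; apply/negPn/negP => ab0.
have phi0 : phi (a - b) = 0 by rewrite rmorphB eq_ab subrr.
have [u Uu] := poly_value ab0; rewrite phi0 scalar0 => /esym/eqP.
by rewrite mulf_eq0 expf_eq0 (negPf pole_neq0) (negPf (unit_neq0 Uu)) andbF.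
Qed.

Lemma Y_neq0 : Y != 0.
Proof.
apply: contra_neq G0 => Y0; apply: pole_poly_in_inj; apply: (@scalar_inj E F).
by rewrite -Ycurve Y0 expr0n gtn_eqF // (rmorph0 phi) scalar0.
Qed.

Lemma uniformizer_expm : exists2 u, U u & t ^+ m = w%:A^-1 * u.
Proof.
have [u Uu Eu] := poly_value G0.
rewrite /t; case: egcdnP => //= km kn; rewrite (eqP mD) => e _.
exists (u ^+ kn); first exact: unitX.
rewrite exprMn exprVn -!exprM e [(kn * m)%N]mulnC exprM Ycurve Eu exprMn -exprM.
have W0 := pole_neq0; rewrite [(D * kn)%N]mulnC addn1 exprS.
have := expf_neq0 (kn * D) W0; move: (w%:A ^+ (kn * D)) (u ^+ kn) => A v A0.
by field; rewrite A0 W0.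
Qed.

Lemma uniformizer_ideal : M t.
Proof.
have [u Uu Et] := uniformizer_expm; apply: (ideal_expn m0); rewrite Et.
by apply/idealMr/unit_ring => //; exact: not_ring_inv.
Qed.

Lemma uniformizer_neq0 : t != 0.
Proof. by rewrite mulf_neq0 ?invr_eq0 ?expf_neq0 ?Y_neq0 ?pole_neq0. Qed.

Lemma w_value : exists2 u, U u & w%:A = t ^ (- m%:Z) * u.
Proof.
have [u Uu Et] := uniformizer_expm; exists u => //.
by rewrite -exprnN Et invfM invrK mulfVK // (unit_neq0 Uu).
Qed.

Lemma Y_value : exists2 u, U u & Y = t ^ (- D%:Z) * u.
Proof.
have tD0 : t ^+ D != 0 by rewrite expf_neq0 ?uniformizer_neq0.
exists (Y * t ^+ D); last by rewrite -exprnN mulrC mulfK.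
apply: (unit_expn m0); have [u Uu Et] := uniformizer_expm.
have [v Uv Ev] := poly_value G0.
rewrite exprMn Ycurve Ev -exprM mulnC exprM Et exprMn mulrACA exprVn divff.
  by rewrite mul1r; apply/unitM/unitX.
by rewrite expf_neq0 ?pole_neq0.
Qed.

(** The pole order of [phi a / phi b * Y ^+ i] where [w] has a pole of order [m] and
    [Y] one of order [D]. *)
Definition order_at_pole (a b : {poly K}) (i : nat) : int :=
  m%:Z * ((deg a)%:Z - (deg b)%:Z) + (i * D)%:Z.

Lemma monomial_value a b i : a != 0 -> b != 0 ->
  exists2 u, U u &
    (phi a / phi b)%:A * Y ^+ i = t ^ (- order_at_pole a b i) * u.
Proof.
move=> a0 b0; have [ua Ua Ea] := poly_value a0; have [ub Ub Eb] := poly_value b0.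
have [uw Uw Ew] := w_value; have [uy Uy Ey] := Y_value.
have t0 := uniformizer_neq0.
exists (uw ^ ((deg a)%:Z - (deg b)%:Z) * (ua / ub) * uy ^+ i).
  by apply/unitM/unitX => //; apply/unitM; [exact: unitXz | apply/unitM/unitV].
rewrite scalarM scalarV Ea Eb invfM mulrACA.
have -> : w%:A ^+ deg a / w%:A ^+ deg b = w%:A ^ ((deg a)%:Z - (deg b)%:Z) :> F.
  by rewrite expfzDr ?pole_neq0 // -invr_expz.
rewrite Ew {1}Ey expfzMl exprMn /order_at_pole opprD (expfzDr _ _ t0).
have -> : (t ^ (- m%:Z)) ^ ((deg a)%:Z - (deg b)%:Z) =
          t ^ (- (m%:Z * ((deg a)%:Z - (deg b)%:Z))).
  by rewrite exprz_exp mulNr.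
have -> : (t ^ (- D%:Z)) ^+ i = t ^ (- (i * D)%:Z).
  by rewrite exprnP exprz_exp mulNr -PoszM mulnC.
by rewrite -!mulrA; congr (_ * _); rewrite !mulrA; congr (_ * _); rewrite mulrC !mulrA.
Qed.

End OnePlace.

(** Modulo [m] the pole orders of the terms [h_i Y ^+ i] are the pairwise distinct
    residues of [i * D], so the term of largest order dominates; which one it is
    can be read off from degrees and does not depend on the place. *)
Lemma dominant_term (p : {poly E}) : p != 0 -> (size p <= m)%N ->
  exists i : nat, [/\ (i < m)%N, p`_i != 0 & forall P : place (in_alg F \o k0),
    ~ place_ring P w%:A ->
    place_unit P ((map_poly (in_alg F) p).[Y] / ((p`_i)%:A * Y ^+ i))].
Proof.
move=> p0 szp.
have frac (h : E) : exists ab : {poly K} * {poly K}, h = phi ab.1 / phi ab.2 /\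
    (h != 0 -> ab.1 != 0 /\ ab.2 != 0).
  have [a [b [b0 Eh]]] := wgen h; exists (a, b); split=> //.
  rewrite Eh mulf_eq0 negb_or => /andP[a0 _]; split=> /=.
    by apply: contra_neq a0 => ->; exact: rmorph0.
  by apply: contra_neq b0 => ->; exact: rmorph0.
have [nd Hnd] := choice frac.
pose ord i := order_at_pole (nd p`_i).1 (nd p`_i).2 i.
have lt_lead : ((size p).-1 < m)%N by rewrite prednK ?size_poly_gt0.
pose j0 := Ordinal lt_lead.
have pj0 : p`_j0 != 0 by rewrite -lead_coefE lead_coef_eq0.
case: (@arg_maxP _ _ _ j0 (fun j : 'I_m => p`_j != 0) (fun j : 'I_m => ord j) pj0).
move=> i pi imax; exists i; split=> // P nOw.
have t0 := uniformizer_neq0 nOw.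
have value (j : nat) : p`_j != 0 -> exists2 u, place_unit P u &
    (p`_j)%:A * Y ^+ j = t ^ (- ord j) * u.
  move=> pj; have [Ej /(_ pj)[n0 d0]] := Hnd p`_j.
  by rewrite {1}Ej; exact: monomial_value.
have term0 : (p`_i)%:A * Y ^+ i != 0.
  by rewrite mulf_neq0 ?expf_neq0 ?(Y_neq0 nOw) // scalar_eq0.
rewrite (@horner_coef_wide _ m) ?size_map_poly // mulr_suml (bigD1 i) //= coef_map /=.
rewrite divff //; apply: unitD; first exact: unit1.
apply: ideal_sum => j ji; rewrite coef_map /=.
have [->|pj] := eqVneq p`_j 0; first by rewrite scalar0 !mul0r; exact: ideal0.
have [ui Ui ->] := value i pi; have [uj Uj ->] := value j pj.
have -> : t ^ (- ord j) * uj / (t ^ (- ord i) * ui) = t ^ (ord i - ord j) * (uj / ui).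
  by rewrite invfM mulrACA invr_expz opprK -expfzDr // addrC.
apply: idealMr; last by apply/unit_ring/unitM/unitV.
have lt_ji : ord j < ord i.
  have le_ji : ord j <= ord i := imax j pj.
  rewrite lt_neqAle le_ji andbT; apply: contraNneq ji => eq_ji; apply/eqP/val_inj.
  exact: order_residue_inj eq_ji.
have : 0 < ord i - ord j by rewrite subr_gt0.
case: (ord i - ord j) => // -[//|n] _; apply: idealX => //.
exact: uniformizer_ideal.
Qed.

End RamifiedPlace.
(** * Polynomials with prescribed roots *)

Section PolyMultiplicity.
Variables (K : closedFieldType) (I : finType) (beta : I -> K).
Hypothesis beta_inj : injective beta.
Implicit Types (nu : I -> nat) (b : {poly K}).

Definition root_prod nu : {poly K} := \prod_k ('X - (beta k)%:P) ^+ nu k.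

Lemma root_prod_monic nu : root_prod nu \is monic.
Proof. by apply: monic_prod => k _; apply/monic_exp/monicXsubC. Qed.

Lemma root_prod_neq0 nu : root_prod nu != 0.
Proof. exact/monic_neq0/root_prod_monic. Qed.

Lemma size_root_prod nu : size (root_prod nu) = (\sum_k nu k).+1.
Proof.
rewrite /root_prod size_prod => [|k _]; last by rewrite expf_neq0 ?polyXsubC_eq0.
under eq_bigr => k _ do rewrite size_exp_XsubC -add1n.
by rewrite big_split /= sum1_card subSn ?leq_addr // addKn.
Qed.

Lemma root_prodD nu nu' :
  root_prod (fun k => nu k + nu' k)%N = root_prod nu * root_prod nu'.
Proof. by rewrite /root_prod -big_split; apply: eq_bigr => k _; rewrite exprD. Qed.

Lemma root_prodX nu n : root_prod (fun k => n * nu k)%N = root_prod nu ^+ n.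
Proof. by rewrite /root_prod -prodrXl; apply: eq_bigr => k _; rewrite mulnC exprM. Qed.

Lemma mup_root_prod nu k : mup (beta k) (root_prod nu) = nu k.
Proof.
rewrite /root_prod (bigD1 k) //= mupMl.
  by rewrite mup_XsubCX eqxx.
rewrite rootE horner_prod; apply/prodf_neq0 => j jk.
rewrite horner_exp hornerXsubC expf_neq0 // subr_eq0.
by apply: contra_neq jk => /beta_inj.
Qed.

Lemma root_root_prod nu x : root (root_prod nu) x -> exists k, x = beta k.
Proof.
rewrite rootE horner_prod => /prodf_eq0[k _]; rewrite horner_exp hornerXsubC.
by rewrite expf_eq0 subr_eq0 => /andP[_ /eqP->]; exists k.
Qed.

Lemma mup_expn x b n : b != 0 -> mup x (b ^+ n) = (n * mup x b)%N.
Proof.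
move=> b0; elim: n => [|n IH]; first by rewrite expr0 mupNroot ?root1.
by rewrite exprS mupM ?expf_neq0 // IH mulSn.
Qed.

Lemma leq_mup_dvdp x b b' : b' != 0 -> b %| b' -> (mup x b <= mup x b')%N.
Proof.
move=> b'0 /dvdpP[q Eb']; have := b'0; rewrite Eb' mulf_eq0 negb_or => /andP[q0 b0].
by rewrite mupM // leq_addl.
Qed.

Lemma size_le_sum_count (s : seq K) :
  (forall x, x \in s -> exists k, x = beta k) ->
  (size s <= \sum_k count_mem (beta k) s)%N.
Proof.
elim: s => // x s IH sb; have [k Ex] := sb x (mem_head x s).
rewrite /= (bigD1 k) //= Ex eqxx -addnA -add1n leq_add2l.
have /IH : forall y, y \in s -> exists k, y = beta k.
  by move=> y ys; apply: sb; rewrite inE ys orbT.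
move/leq_trans; apply; rewrite (bigD1 k) //= leq_add2l; apply: leq_sum => j _.
exact: leq_addl.
Qed.

(** An [m]-th power dividing the product takes at most [nu k %/ m] factors at each
    root. *)
Lemma size_dvdp_root_prod m nu b : (0 < m)%N -> b != 0 -> b ^+ m %| root_prod nu ->
  ((size b).-1 <= \sum_k nu k %/ m)%N.
Proof.
move=> m0 b0 dvd_b; have [s Eb] := closed_field_poly_normal b.
have lb0 : lead_coef b != 0 by rewrite lead_coef_eq0.
have mups x : mup x b = count_mem x s.
  rewrite Eb -mul_polyC mupMr ?mu_prod_XsubC //.
  by rewrite rootE hornerC.
have -> : (size b).-1 = size s by rewrite Eb size_scale // size_prod_XsubC.
have ss x : x \in s -> exists k, x = beta k.
  move=> xs; apply: (@root_root_prod nu); rewrite -dvdp_XsubCl.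
  apply: dvdp_trans dvd_b; rewrite dvdp_XsubCl rootE horner_exp expf_eq0 m0.
  by rewrite Eb hornerZ mulf_eq0 -[X in _ || X]rootE root_prod_XsubC xs orbT.
apply: leq_trans (size_le_sum_count ss) _; apply: leq_sum => k _.
rewrite leq_divRL // mulnC -mups -mup_expn // -[leqRHS]mup_root_prod.
by apply: leq_mup_dvdp; rewrite // root_prod_neq0.
Qed.

End PolyMultiplicity.
(** * Integral closure of the polynomial ring *)

Section IntegralClosure.
Variables (K : closedFieldType) (E : fieldType) (k0 : {rmorphism K -> E}) (w : E).
Local Notation phi := (poly_in k0 w).
Hypotheses (wgen : generates k0 w) (phi_inj : injective phi).

Lemma poly_in_eq0 a : (phi a == 0) = (a == 0).
Proof. exact: raddf_eq0. Qed.

Lemma reduced_fraction h :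
  exists a b : {poly K}, [/\ coprimep a b, b != 0 & h = phi a / phi b].
Proof.
have [a [b [phib0 ->]]] := wgen h; have b0 : b != 0 by rewrite -poly_in_eq0.
exists (a %/ gcdp a b), (b %/ gcdp a b).
have g0 : gcdp a b != 0 by rewrite gcdp_eq0 negb_and b0 orbT.
have [Ea Eb] := (divpK (dvdp_gcdl a b), divpK (dvdp_gcdr a b)).
have b'0 : b %/ gcdp a b != 0 by apply: contraNneq b0 => b'0; rewrite -Eb b'0 mul0r.
split=> //; first by rewrite coprimep_div_gcd // b0 orbT.
rewrite -[X in phi X / _ = _]Ea -[X in _ / phi X = _]Eb !rmorphM /= invfM mulrACA.
rewrite divff ?mulr1 //.
by rewrite poly_in_eq0.
Qed.

(** At a root of the denominator of a reduced fraction, clearing denominators in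
    a monic equation leaves a power of the numerator. *)
Lemma poly_in_integrally_closed h : integralOver phi h -> exists a, h = phi a.
Proof.
have [a [b [ab b0 Eh]]] := reduced_fraction h; case=> q q_monic qh.
have phib0 : phi b != 0 by rewrite poly_in_eq0.
pose n := (size q).-1.
have szq : size q = n.+1 by rewrite prednK // size_poly_gt0 monic_neq0.
have sum0 : \sum_(i < n.+1) q`_i * a ^+ i * b ^+ (n - i) = 0.
  apply: phi_inj; rewrite rmorph0 rmorph_sum.
  move: qh => /rootP/(congr1 (fun x => x * phi b ^+ n)).
  rewrite mul0r (@horner_coef_wide _ n.+1) -?szq ?size_poly // szq mulr_suml => qh.
  rewrite -[RHS]qh; apply: eq_bigr => i _; rewrite coef_map !rmorphM !rmorphXn Eh.
  have -> : phi b ^+ n = phi b ^+ (n - i) * phi b ^+ i by rewrite -exprD subnK // -ltnS.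
  rewrite expr_div_n; have := expf_neq0 i phib0.
  by move: (phi b ^+ i) (phi b ^+ (n - i)) (phi a ^+ i) => x y t x0; field.
have b_const : size b == 1%N.
  apply/negPn/negP => /closed_rootP[x bx].
  have := coprimep_root ab; rewrite coprimep_sym in ab; have := coprimep_root ab bx.
  move: sum0 => /(congr1 (fun g => g.[x])); rewrite horner0 horner_sum big_ord_recr /=.
  rewrite big1 => [|i _]; last first.
    by rewrite !hornerM !horner_exp (rootP bx) expr0n subn_eq0 leqNgt ltn_ord mulr0.
  rewrite add0r subnn mulr1 -lead_coefE (monicP q_monic) mul1r horner_exp.
  by move=> /eqP; rewrite expf_eq0 => /andP[_ ->].
have Eb := size1_polyC (eq_leq (eqP b_const)).
have c0 : b`_0 != 0 by apply: contraNneq b0 => c0; rewrite Eb c0.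
exists ((b`_0)^-1 *: a); rewrite Eh [in LHS]Eb poly_inC -mul_polyC rmorphM.
by rewrite poly_inC fmorphV mulrC.
Qed.

End IntegralClosure.

Section KummerExtension.
Variables (K : closedFieldType) (E : fieldType) (k0 : {rmorphism K -> E}) (w : E).
Variables (F : fieldExtType E) (m : nat) (G : {poly K}) (Y : F).
Local Notation phi := (poly_in k0 w).
Local Notation eval p := (map_poly (in_alg F) p).[Y].
Hypotheses (m0 : m%:R != 0 :> K) (Ycurve : Y ^+ m = (phi G)%:A).
Hypothesis Yfree : forall p : {poly E}, p != 0 -> (size p <= m)%N -> eval p != 0.

Let m_gt0 : (0 < m)%N. Proof. by case: m m0 => //; rewrite eqxx. Qed.

Lemma exists_prim_root : exists z : K, m.-primitive_root z.
Proof.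
have [s Es] := closed_field_poly_normal ('X^m - 1 : {poly K}).
rewrite lead_coefXnsubC // scale1r in Es.
have us : uniq s by rewrite -separable_prod_XsubC -Es separable_Xn_sub_1.
have szs : size s = m by apply/eqP; rewrite -eqSS -(size_prod_XsubC s id) -Es size_XnsubC.
have := @cyclic.has_prim_root _ _ _ m_gt0 _ us; rewrite szs leqnn.
move=> /(_ _ isT)/hasP[]; last by move=> z _ zm; exists z.
by apply/allP => z zs; rewrite /root_of_unity Es root_prod_XsubC.
Qed.

(** The substitution of [eta * Y] for [Y] respects the equation [Y ^+ m = phi G],
    hence preserves all polynomial relations satisfied by [Y]. *)
Lemma root_conjugate (eta : F) (p : {poly E}) : eta ^+ m = 1 ->
  eval p = 0 -> (map_poly (in_alg F) p).[eta * Y] = 0.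
Proof.
move=> etam pY; pose N : {poly E} := 'X^m - (phi G)%:P.
have szN : size N = m.+1 by rewrite size_XnsubC.
have Nroot x : x ^+ m = Y ^+ m -> (map_poly (in_alg F) N).[x] = 0.
  by move=> xm; rewrite rmorphB /= map_polyXn map_polyC !hornerE xm Ycurve subrr.
have szr : (size (p %% N)%R <= m)%N by rewrite -ltnS -szN ltn_modp -size_poly_eq0 szN.
have r0 : p %% N = 0.
  apply: contraPeq pY => r0; apply/eqP; rewrite (divp_eq p N) rmorphD rmorphM /=.
  by rewrite hornerD hornerM Nroot // mulr0 add0r Yfree.
rewrite (divp_eq p N) r0 addr0 rmorphM hornerM Nroot ?mulr0 //.
by rewrite exprMn etam mul1r.
Qed.

Local Notation integral := (integralOver (in_alg F \o phi)).

Lemma integral_const c : integral (k0 c)%:A.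
Proof.
have -> : (k0 c)%:A = (in_alg F \o phi) c%:P by rewrite /= -(poly_inC k0 w).
exact: integral_id.
Qed.

Lemma integral_conjugate (eta : F) (p : {poly E}) : eta ^+ m = 1 ->
  integral (eval p) -> integral (map_poly (in_alg F) p).[eta * Y].
Proof.
move=> etam [q q_monic qp]; exists q => //; apply/rootP.
have compE x : (map_poly (in_alg F \o phi) q).[(map_poly (in_alg F) p).[x]] =
    (map_poly (in_alg F) (map_poly phi q \Po p)).[x].
  by rewrite map_comp_poly horner_comp map_poly_comp.
by rewrite compE; apply: root_conjugate => //; rewrite -compE; apply/rootP.
Qed.

(** Averaging the conjugates against a character of the group of [m]-th roots of
    unity isolates one term. *)
Lemma integral_term (p : {poly E}) i : (size p <= m)%N -> (i < m)%N ->
  integral (eval p) -> integral ((p`_i)%:A * Y ^+ i).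
Proof.
move=> szp im int_p; have [z zm] := exists_prim_root.
have z1 : z ^+ m = 1 := prim_expr_order zm.
pose eta s : F := (k0 (z ^+ s))%:A.
have etaX s : eta s ^+ m = 1.
  by rewrite /eta -scalarX -rmorphXn -exprM mulnC exprM z1 expr1n rmorph1 scalar1.
have int_sum : integral (\sum_(s < m)
    (k0 (z ^+ (s * (m - i))))%:A * (map_poly (in_alg F) p).[eta s * Y]).
  apply: (big_ind (fun x => integral x)); first exact: integral0.
    by move=> x y; exact: integral_add.
  move=> s _; apply: integral_mul; first exact: integral_const.
  by apply: integral_conjugate.
have -> : (p`_i)%:A * Y ^+ i = (k0 m%:R^-1)%:A * \sum_(s < m)
    (k0 (z ^+ (s * (m - i))))%:A * (map_poly (in_alg F) p).[eta s * Y].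
  under eq_bigr => s _ do
    rewrite (@horner_coef_wide _ m) ?size_map_poly // mulr_sumr.
  have termE (j : 'I_m) : \sum_(s < m) (k0 (z ^+ (s * (m - i))))%:A *
      ((map_poly (in_alg F) p)`_j * (eta s * Y) ^+ j) =
      (p`_j)%:A * Y ^+ j * (k0 (\sum_(s < m) (z ^+ (m - i + j)) ^+ s))%:A.
    rewrite rmorph_sum scalar_sum mulr_sumr; apply: eq_bigr => s _.
    rewrite coef_map /= exprMn.
    have -> : eta s ^+ j = (k0 (z ^+ (s * j)))%:A.
      by rewrite /eta -scalarX -rmorphXn -exprM.
    have -> : (z ^+ (m - i + j)) ^+ s = z ^+ (s * (m - i)) * z ^+ (s * j).
      by rewrite -exprM -exprD mulnC mulnDr.
    by rewrite rmorphM scalarM; ring.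
  rewrite exchange_big /= (bigD1 (Ordinal im)) //= [X in _ + X]big1 => [|j ji].
    rewrite addr0 (termE (Ordinal im)) /= subnK 1?ltnW // z1.
    rewrite [X in _ * (k0 X)%:A](eq_bigr (fun=> 1)) => [|s _]; last by rewrite expr1n.
    rewrite sumr_const card_ord mulrCA -scalarM -rmorphM mulVf //.
    by rewrite rmorph1 scalar1 mulr1.
  rewrite termE; set xi := z ^+ _.
  have xi1 : xi != 1.
    rewrite /xi -(prim_order_dvd zm); apply: contra ji => /dvdnP[q Eq].
    apply/eqP/val_inj => /=; have : (m - i + j = m)%N; last by lia.
    have jm := ltn_ord j; case: q Eq => [|[|q]]; lia.
  have xim : xi ^+ m = 1 by rewrite /xi -exprM mulnC exprM z1 expr1n.
  have /esym/eqP := subrX1 xi m; rewrite xim subrr mulf_eq0 subr_eq0 (negPf xi1).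
  by move=> /eqP->; rewrite rmorph0 scalar0 mulr0.
by apply: integral_mul => //; exact: integral_const.
Qed.

End KummerExtension.
(** * The Weierstrass semigroup at the pole *)

Section PoleSemigroup.
Variables (K : closedFieldType) (E : fieldType) (k0 : {rmorphism K -> E}) (w : E).
Variables (F : fieldExtType E) (m : nat) (Y : F).
Variables (I : finType) (beta : I -> K) (mu : I -> nat) (c : K).
Local Notation phi := (poly_in k0 w).
Local Notation eval p := (map_poly (in_alg F) p).[Y].
Local Notation G := (c *: root_prod beta mu).
Local Notation D := (\sum_k mu k)%N.
Hypotheses (m0 : m%:R != 0 :> K) (c0 : c != 0) (beta_inj : injective beta).
Hypotheses (mD : coprime m D) (Ycurve : Y ^+ m = (phi G)%:A).
Hypothesis wgen : generates k0 w.
Hypothesis Ygen : forall z : F, exists2 p : {poly E}, (size p <= m)%N & z = eval p.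
Variable Q : place (in_alg F \o k0).
Hypothesis nOw : ~ place_ring Q w%:A.
Local Notation t := (uniformizer w m G Y).
Local Notation ord := (order_at_pole m G).

Let m_gt0 : (0 < m)%N. Proof. by case: m m0 => //; rewrite eqxx. Qed.

Let degG : (size G).-1 = D. Proof. by rewrite size_scale // size_root_prod. Qed.

Let G0 : G != 0. Proof. by rewrite scaler_eq0 negb_or c0 root_prod_neq0. Qed.

Let mG : coprime m (size G).-1. Proof. by rewrite degG. Qed.

Lemma pole_value z : z != 0 -> exists n : int,
  forall P : place (in_alg F \o k0), ~ place_ring P w%:A ->
    exists2 u, place_unit P u & z = t ^ n * u.
Proof.
have [p szp ->] := Ygen z => z0.
have p0 : p != 0 by apply: contra_neq z0 => ->; rewrite rmorph0 horner0.
have [i [im pi Up]] := dominant_term m_gt0 G0 mG Ycurve wgen p0 szp.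
have [a [b [b0 Eh]]] := wgen p`_i.
have a0 : a != 0 by apply: contra_neq pi; rewrite Eh => ->; rewrite rmorph0 mul0r.
have {}b0 : b != 0 by apply: contra_neq b0 => ->; rewrite rmorph0.
exists (- ord a b i) => P nOwP.
have [u Uu Eu] := monomial_value m_gt0 G0 mG Ycurve nOwP i a0 b0.
have {}Up := Up P nOwP.
exists (u * (eval p / ((p`_i)%:A * Y ^+ i))); first exact: unitM.
rewrite mulrA -Eu -Eh mulrC mulfVK //.
by rewrite mulf_neq0 ?expf_neq0 ?(Y_neq0 m_gt0 G0 Ycurve nOwP) // scalar_eq0.
Qed.

Lemma pole_ring_value (P : place (in_alg F \o k0)) (n : int) u :
  ~ place_ring P w%:A -> place_unit P u -> place_ring P (t ^ n * u) <-> 0 <= n.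
Proof.
move=> nOwP Uu; have t0 := uniformizer_neq0 m_gt0 G0 Ycurve nOwP.
have Mt := uniformizer_ideal m_gt0 G0 mG Ycurve nOwP.
case: n => n; split=> //.
  by move=> _; exact: (ringM (ringX n (ideal_ring Mt)) (unit_ring Uu)).
move=> Oz; case: (ideal_not_inv (idealX (ltn0Sn n) Mt)); first by rewrite expf_neq0.
rewrite -[X in place_ring P X](mulfK (unit_neq0 Uu)).
exact/(ringM Oz)/unit_ring/unitV.
Qed.

(** Membership in the valuation ring is decided by a value that does not depend on
    the place. *)
Lemma pole_place_unique (P : place (in_alg F \o k0)) : ~ place_ring P w%:A -> P = Q.
Proof.
move=> nOwP; apply/place_eq/funext => z; apply/propext.
have [->|z0] := eqVneq z 0; first by split=> _; exact: ring0.
have [n nval] := pole_value z0.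
have [u Uu Eu] := nval P nOwP; have [v Uv Ev] := nval Q nOw.
have valP := pole_ring_value n nOwP Uu; have valQ := pole_ring_value n nOw Uv.
by rewrite {1}Eu Ev; exact: iff_trans valP (iff_sym valQ).
Qed.

Lemma uniformizer_prime : prime_element Q t.
Proof.
apply: prime_elementI; first exact: uniformizer_ideal nOw.
by move=> z /pole_value[n /(_ Q nOw)]; exists n.
Qed.

(** The pole makes [1, Y, ..., Y ^+ m.-1] linearly independent: the dominant term
    shows that no nontrivial combination vanishes. *)
Lemma Y_free (p : {poly E}) : p != 0 -> (size p <= m)%N -> eval p != 0.
Proof.
move=> p0 szp.
have [i [_ _ /(_ Q nOw)/unit_neq0]] := dominant_term m_gt0 G0 mG Ycurve wgen p0 szp.
by rewrite mulf_eq0 negb_or => /andP[].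
Qed.

Let phi_inj : injective phi. Proof. exact: pole_poly_in_inj nOw. Qed.

Local Notation integral := (integralOver (in_alg F \o phi)).

Lemma valuation_monomial a b i : a != 0 -> b != 0 ->
  valuation Q ((phi a / phi b)%:A * Y ^+ i) = - ord a b i.
Proof.
move=> a0 b0; have [u Uu ->] := monomial_value m_gt0 G0 mG Ycurve nOw i a0 b0.
exact: valuationE uniformizer_prime Uu.
Qed.

(** Integral elements lie in every valuation ring that contains [w], that is, in all
    but that of [Q]. *)
Lemma pole_divisor_integral (z : F) (n : nat) : integral z -> valuation Q z = - n%:Z ->
  pole_divisor z = prime_divisor Q *+ n.
Proof.
move=> int_z vz; apply/funext => P; rewrite natmulfctE /pole_divisor /prime_divisor.
case: asboolP => [->|PQ].
  rewrite vz; case: n vz => [|n] _; first by rewrite oppr0 ltxx.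
  by rewrite oppr_lt0 ltz_nat opprK natz.
rewrite mul0rn ltNge; case: negP => // -[]; apply: valuation_ge0.
apply: (integral_ring _ int_z) => a /=; apply: ring_poly_in.
by apply: contrapT => /pole_place_unique.
Qed.

(** A nonintegral element has a pole at some place where [w] is regular; that this
    pole is seen by [valuation] uses that such a place is discrete. *)
Lemma integral_of_pole_divisor (z : F) n :
  pole_divisor z = prime_divisor Q *+ n -> integral z.
Proof.
move=> zQ; apply: contrapT => nint.
have [|P [OP nOz]] := exists_place (k := in_alg F \o k0) _ nint.
  by move=> d; exists d%:P; rewrite /= -(poly_inC k0 w).
have OwP : place_ring P w%:A by rewrite -(poly_inX k0 w); exact: OP.
have vz := valuation_lt0_finite wgen phi_inj OwP nOz.
have PQ : P <> Q by move=> PQ; apply: nOw; rewrite -PQ.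
move: zQ => /(congr1 (fun f => f P)).
rewrite natmulfctE /pole_divisor /prime_divisor vz; case: asboolP => // _.
by rewrite mul0rn => /eqP; rewrite oppr_eq0 lt_eqF.
Qed.

(** If [z] is regular outside [Q], so is each of its terms [h * Y ^+ i]. Its [m]-th
    power [h ^+ m * phi G ^+ i] is then a polynomial in [w], so that the denominator
    of [h] divides the product of the [('X - beta k) ^+ (i * mu k %/ m)]. The dominant
    term has the same pole order as [z], and the remaining freedom is the degree of
    the polynomial that multiplies the inverse of this product. *)
Lemma pole_semigroupE n : weierstrass_semigroup Q n <->
  exists i d : nat, (i < m)%N /\
    (n + m * \sum_k (i * mu k) %/ m = i * D + m * d)%N.
Proof.
split=> [[z zQ]|[i [d [im eq_n]]]]; last first.
  pose nu k := (i * mu k %/ m)%N; pose B := root_prod beta nu.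
  have B0 : B != 0 by exact: root_prod_neq0.
  have Xd0 : 'X^d != 0 :> {poly K} by rewrite -size_poly_eq0 size_polyXn.
  exists ((phi 'X^d / phi B)%:A * Y ^+ i); apply: pole_divisor_integral.
    have EG : G ^+ i = B ^+ m * (c ^+ i *: root_prod beta (fun k => i * mu k %% m)%N).
      rewrite exprZn -scalerAr; congr (_ *: _).
      rewrite -!root_prodX -root_prodD; congr root_prod; apply/funext => k.
      by rewrite /nu [(m * _)%N]mulnC -divn_eq.
    pose g := 'X^d ^+ m * (c ^+ i *: root_prod beta (fun k => i * mu k %% m)%N).
    have Eg : ((phi 'X^d / phi B)%:A * Y ^+ i) ^+ m = (phi g)%:A.
      rewrite exprMn -exprM mulnC exprM Ycurve -!scalarX -scalarM -rmorphXn EG.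
      congr (_ %:A); rewrite expr_div_n -!rmorphXn rmorphM /g rmorphM.
      have : phi (B ^+ m) != 0 by rewrite poly_in_eq0 // expf_neq0.
      by move: (phi (B ^+ m)) (phi (_ ^+ m)) (phi (_ *: _)) => x y s x0; field.
    exists ('X^m - g%:P); first exact: monicXnsubC.
    by apply/rootP; rewrite rmorphB /= map_polyXn map_polyC !hornerE Eg subrr.
  rewrite valuation_monomial //; congr (- _); rewrite /order_at_pole degG.
  rewrite size_polyXn /= size_root_prod /=.
  have {}eq_n : n%:Z + m%:Z * (\sum_k nu k)%N%:Z = i%:Z * D%:Z + m%:Z * d%:Z.
    by rewrite -!PoszM -!PoszD eq_n.
  by apply: (addIr (m%:Z * (\sum_k nu k)%N%:Z)); rewrite eq_n PoszM; ring.
have [n0|n_gt0] := posnP n.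
  exists 0%N, 0%N; split=> //; rewrite n0 !mul0n muln0 addn0 add0n.
  by rewrite big1 ?muln0 // => k _; rewrite mul0n div0n.
have int_z := integral_of_pole_divisor zQ.
have vz : valuation Q z = - n%:Z.
  move: zQ => /(congr1 (fun f => f Q)); rewrite natmulfctE /pole_divisor /prime_divisor.
  case: asboolP => // _; rewrite natz; case: ifP => [_ <-|_]; first by rewrite opprK.
  by move=> n0; move: n_gt0; rewrite -ltz_nat -n0 ltxx.
have [p szp Ez] := Ygen z.
have p0 : p != 0.
  apply: contraTneq n_gt0 => p0; move: vz; rewrite Ez p0 rmorph0 horner0 valuation0.
  by move=> n0; lia.
have [i [im pi /(_ Q nOw) Up]] := dominant_term m_gt0 G0 mG Ycurve wgen p0 szp.
have int_i : integral ((p`_i)%:A * Y ^+ i).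
  by apply: (integral_term m0 Ycurve Y_free) => //; rewrite -Ez.
have [a [b [ab b0 Eh]]] := reduced_fraction wgen phi_inj p`_i.
have a0 : a != 0 by apply: contra_neq pi; rewrite Eh => ->; rewrite rmorph0 mul0r.
have dvd_b : b ^+ m %| root_prod beta (fun k => i * mu k)%N.
  have [g Eg] : exists g, (phi a / phi b) ^+ m * phi G ^+ i = phi g.
    apply: (poly_in_integrally_closed wgen phi_inj).
    have int_im : integral (((p`_i)%:A * Y ^+ i) ^+ m).
      elim: (m) => [|d IH]; first by rewrite expr0; exact: integral1.
      by rewrite exprS; exact: integral_mul.
    case: int_im => q q_monic; rewrite map_poly_comp.
    have -> : ((p`_i)%:A * Y ^+ i) ^+ m = in_alg F ((phi a / phi b) ^+ m * phi G ^+ i).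
      by rewrite exprMn -exprM mulnC exprM Ycurve -!scalarX -scalarM Eh.
    by rewrite fmorph_root => qr; exists q.
  have : b ^+ m %| a ^+ m * root_prod beta (fun k => i * mu k)%N.
    rewrite -(dvdpZr _ _ (expf_neq0 i c0)) scalerAr root_prodX -exprZn.
    apply/dvdpP; exists g; apply: phi_inj; rewrite !rmorphM !rmorphXn -Eg.
    by rewrite expr_div_n mulrAC mulfVK // expf_neq0 // poly_in_eq0.
  by rewrite Gauss_dvdpr // coprimep_expl // coprimep_expr // coprimep_sym.
have le_b := size_dvdp_root_prod beta_inj m_gt0 b0 dvd_b.
exists i, ((size a).-1 + (\sum_k i * mu k %/ m - (size b).-1))%N; split=> //.
have eq_n : n%:Z = ord a b i.
  have [u Uu Eu] := monomial_value m_gt0 G0 mG Ycurve nOw i a0 b0.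
  apply: oppr_inj; rewrite -vz.
  have -> : z = t ^ (- ord a b i) * (u * (z / ((p`_i)%:A * Y ^+ i))).
    rewrite [RHS]mulrA -Eu -Eh mulrC mulfVK //.
    by rewrite mulf_neq0 ?expf_neq0 ?(Y_neq0 m_gt0 G0 Ycurve nOw) // scalar_eq0.
  by apply: (valuationE _ uniformizer_prime); apply: unitM => //; rewrite Ez.
have : n%:Z + m%:Z * (\sum_k i * mu k %/ m)%N%:Z = i%:Z * D%:Z +
    m%:Z * ((size a).-1%:Z + ((\sum_k i * mu k %/ m)%N%:Z - (size b).-1%:Z)).
  by rewrite eq_n /order_at_pole degG PoszM; ring.
by rewrite subzn // -PoszD -!PoszM -!PoszD => -[].
Qed.

End PoleSemigroup.
(** * Gaps modulo m and ceilings *)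

Section Ceilings.
Implicit Types (a b q : int) (m : nat).

Lemma ceil_ratio a m : (0 < m)%N ->
  Num.ceil (a%:~R / m%:R : rat) = - ((- a) %/ m%:Z)%Z.
Proof.
move=> m0; rewrite ceilNfloor -mulNr -rmorphN; congr (- _); move: (- a) => b.
apply: floor_def; rewrite -[m%:R]/(m%:Z%:~R).
have m0' : 0 < m%:Z%:~R :> rat by rewrite ltr0z ltz_nat.
rewrite ler_pdivlMr // ltr_pdivrMr // -!rmorphM /= ler_int ltr_int.
by rewrite lez_floor ?ltz_ceil // ?ltz_nat // gt_eqF // ltz_nat.
Qed.

Variables (m : nat) (I : finType) (lambda : I -> nat) (l : I) (lambda0 lam : nat).
Hypotheses (m_gt1 : (1 < m)%N) (lambda0E : lambda0 = (\sum_k lambda k)%N).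
Hypotheses (m_lambda0 : coprime m lambda0)
  (lam_inv : (lam * lambda l = 1 %[mod m])%N).

Let m_gt0 : (0 < m)%N. Proof. exact: ltnW. Qed.

(** The ceiling of [a / m]. *)
Definition cdiv a : int := - ((- a) %/ m%:Z)%Z.

Definition gap_bound (i : nat) : int :=
  \sum_k cdiv (i * lam * lambda k)%N - cdiv (i * lam * lambda0)%N.

Let mz0 : m%:Z != 0. Proof. by rewrite eqz_nat -lt0n. Qed.

Lemma cdiv_notdvd a : ~~ (m %| a)%Z -> cdiv a = (a %/ m%:Z)%Z + 1.
Proof.
move=> ndvd; rewrite /cdiv {1}(divz_eq a m%:Z) opprD -mulNr divzMDl // opprD opprK.
congr (_ + _); have r0 : (a %% m%:Z)%Z != 0 by apply: contra ndvd => /eqP/dvdz_mod0P.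
have := modz_ge0 a mz0; have : (a %% m%:Z)%Z < m%:Z by rewrite ltz_pmod // ltz_nat.
case: (a %% m%:Z)%Z r0 => // -[//|r] _ rm _.
by rewrite -NegzE divNz_nat // opprK divn_small // ltnW.
Qed.

(** The multiplicities of the roots of the polynomial equal to the [m]-th power of
    [y * w ^+ lambda0], where [w] has its pole at the place of index [l]; this index
    then stands for the place where [y] has its poles. *)
Definition pole_mult (k : I) : nat := if k == l then ((m - 1) * lambda0)%N else lambda k.

Lemma sum_pole_mult : (\sum_k pole_mult k + lambda l = m * lambda0)%N.
Proof.
rewrite (bigD1 l) //= {1}/pole_mult eqxx.
rewrite (eq_bigr lambda) => [|k kl]; last by rewrite /pole_mult (negPf kl).
have El0 : lambda0 = (lambda l + \sum_(k | k != l) lambda k)%N.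
  by rewrite lambda0E (bigD1 l).
rewrite -addnA [X in (_ + X)%N]addnC -El0.
by rewrite -mulSnr subn1 prednK.
Qed.

Lemma coprime_inverse : coprime m lam && coprime m (lambda l).
Proof. by rewrite -coprimeMr -coprime_modr lam_inv coprime_modr coprimen1. Qed.

Lemma coprime_sum_pole_mult : coprime m (\sum_k pole_mult k).
Proof.
have /andP[_ ml] := coprime_inverse.
rewrite /coprime -dvdn1 -(eqP ml) dvdn_gcd dvdn_gcdl /=.
rewrite -(dvdn_addr _ (dvdn_gcdr m (\sum_k pole_mult k))) sum_pole_mult.
by rewrite dvdn_mulr // dvdn_gcdl.
Qed.

(** The exponent is [- i0 * lam] modulo [m], because the sum of the multiplicities
    is [- lambda l] modulo [m]. *)
Lemma pole_exponent (i0 : nat) : (0 < i0 < m)%N -> exists2 i : nat, (i < m)%N &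
  (i * \sum_k pole_mult k)%N%:Z =
    i0%:Z + m%:Z * gap_bound i0 + m%:Z * (\sum_k i * pole_mult k %/ m)%N%:Z.
Proof.
move=> /andP[i00 i0m]; pose e : int := - (i0 * lam)%N%:Z.
exists `|(e %% m%:Z)%Z|%N.
  by rewrite -ltz_nat gez0_abs ?modz_ge0 // ltz_pmod // ltz_nat.
set i := `|_|%N; pose q := - (e %/ m%:Z)%Z.
have Ei : i%:Z = e + q * m%:Z.
  by rewrite /i gez0_abs ?modz_ge0 // {2}(divz_eq e m%:Z) /q; ring.
have floorE k : (i * pole_mult k %/ m)%N%:Z =
    q * (pole_mult k)%:Z + ((e * (pole_mult k)%:Z) %/ m%:Z)%Z.
  by rewrite -divz_nat PoszM Ei mulrDl addrC mulrAC divzMDl.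
have sumfloor : (\sum_k i * pole_mult k %/ m)%N%:Z = q * (\sum_k pole_mult k)%N%:Z +
    \sum_k ((e * (pole_mult k)%:Z) %/ m%:Z)%Z.
  rewrite !(big_morph Posz PoszD (erefl 0%:Z)) mulr_sumr -big_split /=.
  by apply: eq_bigr => k _; exact: floorE.
have floor_l : ((e * (pole_mult l)%:Z) %/ m%:Z)%Z =
    e * lambda0%:Z + cdiv (i0 * lam * lambda0)%N - 1.
  rewrite cdiv_notdvd; last first.
    have /andP[m_lam _] := coprime_inverse.
    rewrite dvdzE !absz_nat -mulnA Gauss_dvdl; last by rewrite coprimeMr m_lam.
    by rewrite gtnNdvd.
  rewrite addrA addrK /pole_mult eqxx -divzMDl //; congr (_ %/ _)%Z.
  by rewrite PoszM -subzn // /e !PoszM; ring.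
have cdiv_l : cdiv (i0 * lam * lambda l)%N =
    i0%:Z * (lam * lambda l %/ m)%N%:Z + 1.
  have Ell := divn_eq (lam * lambda l) m; rewrite lam_inv modn_small // in Ell.
  have -> : (i0 * lam * lambda l)%N%:Z =
      (i0%:Z * (lam * lambda l %/ m)%N%:Z) * m%:Z + i0%:Z.
    by rewrite -mulnA {1}Ell !PoszM PoszD PoszM; ring.
  rewrite cdiv_notdvd.
    have i0_div : (i0%:Z %/ m%:Z)%Z = 0 by rewrite divz_nat divn_small.
    by rewrite divzMDl // i0_div addr0.
  by rewrite rpredDl ?dvdz_mull // dvdzE !absz_nat gtnNdvd.
have Ell : (lam * lambda l)%N%:Z = (lam * lambda l %/ m)%N%:Z * m%:Z + 1.
  by rewrite {1}(divn_eq (lam * lambda l) m) lam_inv modn_small // PoszD PoszM.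
have ED : (\sum_k pole_mult k)%N%:Z = m%:Z * lambda0%:Z - (lambda l)%:Z.
  by rewrite -PoszM -sum_pole_mult PoszD addrK.
have floor_other : \sum_(k | k != l) ((e * (pole_mult k)%:Z) %/ m%:Z)%Z =
    - \sum_(k | k != l) cdiv (i0 * lam * lambda k)%N.
  rewrite -sumrN; apply: eq_bigr => k kl.
  by rewrite /pole_mult (negPf kl) /cdiv opprK /e !PoszM mulNr.
rewrite sumfloor PoszM Ei ED (bigD1 l) //= floor_l floor_other.
rewrite /gap_bound (bigD1 l) //= cdiv_l.
move: (\sum_(k | k != l) cdiv _) (cdiv _) Ell => S C.
rewrite /e !PoszM; move: (_ %/ m)%N%:Z => e' Ell.
have -> : (- (i0%:Z * lam%:Z) + q * m%:Z) * (m%:Z * lambda0%:Z - (lambda l)%:Z) =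
    (- (i0%:Z * lam%:Z) + q * m%:Z) * (m%:Z * lambda0%:Z) +
    i0%:Z * (lam%:Z * (lambda l)%:Z) - q * m%:Z * (lambda l)%:Z by ring.
by rewrite Ell; ring.
Qed.

(** Each residue class modulo [m] comes from exactly one exponent [i], and in that
    class the semigroup is a half-line. *)
Lemma pole_gapE (n : nat) :
  ~ (exists i d : nat, (i < m)%N /\ (n + m * \sum_k i * pole_mult k %/ m =
       i * \sum_k pole_mult k + m * d)%N) <->
  exists i j : int, [/\ 1 <= i <= m%:Z - 1, 0 <= j <= gap_bound `|i|%N - 1
    & n%:Z = i + m%:Z * j].
Proof.
have mD := coprime_sum_pole_mult.
split=> [nogap|[i [j [/andP[i1 im] /andP[j0 jb] En]]] [e [d [em Ee]]]].
  pose i0 := (n %% m)%N; pose j := (n %/ m)%N.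
  have En : n%:Z = i0%:Z + m%:Z * j%:Z.
    by rewrite {1}(divn_eq n m) PoszD PoszM addrC mulrC.
  have i0m : (i0 < m)%N by rewrite ltn_mod.
  have [i00|i0_gt0] := posnP i0.
    case: nogap; exists 0%N, j; split=> //; rewrite mul0n add0n big1 ?muln0 ?addn0.
      by apply: (can_inj absz_nat); rewrite En i00 add0r PoszM.
    by move=> k _; rewrite mul0n div0n.
  exists i0%:Z, j%:Z; split=> //; first by lia.
  rewrite absz_nat; have [j_lt|gap_le] := ltP j%:Z (gap_bound i0); first by lia.
  have [|i im Ei] := pole_exponent (i0 := i0); first by rewrite i0_gt0.
  case: nogap; exists i, `|(j%:Z - gap_bound i0)%R|%N; split=> //.
  have Ed : `|(j%:Z - gap_bound i0)%R|%N%:Z = j%:Z - gap_bound i0.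
    by rewrite gez0_abs // subr_ge0.
  suff : n%:Z + m%:Z * (\sum_k i * pole_mult k %/ m)%N%:Z =
      (i * \sum_k pole_mult k)%N%:Z + m%:Z * `|(j%:Z - gap_bound i0)%R|%N%:Z.
    by rewrite -!PoszM -!PoszD => -[].
  by rewrite Ed Ei En; ring.
case: i i1 im En jb => // i i1 im En jb; rewrite /= in jb.
have [|i' i'm Ei'] := pole_exponent (i0 := i); first by lia.
have Ee' : n%:Z + m%:Z * (\sum_k e * pole_mult k %/ m)%N%:Z =
    (e * \sum_k pole_mult k)%N%:Z + m%:Z * d%:Z by rewrite -!PoszM -!PoszD Ee.
have e_i' : e = i'.
  apply: (order_residue_inj mD em i'm (x := d%:Z - (\sum_k e * pole_mult k %/ m)%N%:Z)
   (x' := j - gap_bound i - (\sum_k i' * pole_mult k %/ m)%N%:Z)).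
  rewrite Ei' mulrBr addrAC [m%:Z * d%:Z + _]addrC -Ee' En; ring.
subst e.
have : m%:Z * (j - gap_bound i - d%:Z) = 0.
  move: Ee'; rewrite Ei' En => /eqP; rewrite -subr_eq0 => /eqP E.
  by rewrite -[RHS]E; ring.
move/eqP; rewrite mulf_eq0 (negPf mz0) /= => /eqP; lia.
Qed.

End Ceilings.
(** * The curve, in the coordinate at the given zero *)

Section FractionField.
Import generic_quotient.
Local Open Scope quotient_scope.

Lemma tofrac_surj (R : idomainType) (x : {fraction R}) :
  exists n d : R, d != 0 /\ x = tofrac n / tofrac d.
Proof.
elim/quotW: x => -[[n d] /= d0]; exists n, d; split=> //.
apply: (canRL (mulfK _)); first by rewrite tofrac_eq0.
unlock tofrac; rewrite -[LHS]FracField.pi_mul /FracField.mulf /=.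
rewrite !numden_Ratio ?oner_eq0 //; apply/eqmodP.
by rewrite /= FracField.equivfE !numden_Ratio ?oner_eq0 // ?mulr1 // mulrC.
Qed.

End FractionField.

Section LocalCoordinate.
Variables (K : closedFieldType) (E : fieldType) (emb : {rmorphism {poly K} -> E}).
Hypotheses (emb_inj : injective emb).
Hypothesis emb_frac : forall h : E, exists g g' : {poly K}, g' != 0 /\ h = emb g / emb g'.
Variable a : K.

(** The coordinate of the line whose pole is at [a]. *)
Definition inv_coord : E := (emb ('X - a%:P))^-1.
Local Notation w := inv_coord.
Local Notation phi := (poly_in (emb \o polyC) w).

Lemma inv_coord_neq0 : w != 0.
Proof. by rewrite invr_eq0 raddf_eq0 // polyXsubC_eq0. Qed.

Lemma emb_linear b : emb ('X - b%:P) = phi (1 - (b - a)%:P * 'X) / w.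
Proof.
have -> : phi (1 - (b - a)%:P * 'X) = 1 - emb (b - a)%:P * w.
  by rewrite rmorphB rmorphM rmorph1 poly_inC poly_inX.
rewrite mulrBl mulfK ?inv_coord_neq0 // /inv_coord invrK mul1r -rmorphB.
by congr (emb _); rewrite polyCB; ring.
Qed.

Lemma inv_coord_generates : generates (emb \o polyC) w.
Proof.
have polyE (g : {poly K}) : exists (b : {poly K}) (n : nat), emb g = phi b / w ^+ n.
  elim/poly_ind: g => [|g c [b [n Eb]]].
    by exists 0, 0%N; rewrite rmorph0 rmorph0 mul0r.
  exists (b * (1 + a%:P * 'X) + c%:P * 'X ^+ n.+1), n.+1.
  have -> : emb (g * 'X + c%:P) = emb g * emb ('X - 0%:P) + emb c%:P.
    by rewrite subr0 rmorphD rmorphM.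
  rewrite emb_linear Eb sub0r polyCN mulNr opprK.
  rewrite !(rmorphD, rmorphM, rmorphXn) /= !(poly_inC, poly_inX).
  have w0 := inv_coord_neq0; have := expf_neq0 n w0; rewrite !exprS /=.
  by move: (w ^+ n) => v v0; field; rewrite v0 w0.
move=> h; have [g [g' [g'0 ->]]] := emb_frac h.
have [b [n Eb]] := polyE g; have [b' [n' Eb']] := polyE g'.
have w0 := inv_coord_neq0.
have phib'0 : phi b' != 0.
  apply: contra_neq g'0 => b'0; apply: emb_inj.
  by rewrite Eb' b'0 mul0r rmorph0.
exists (b * 'X ^+ n'), (b' * 'X ^+ n).
rewrite !rmorphM !rmorphXn /= poly_inX; split; first by rewrite mulf_neq0 ?expf_neq0.
rewrite Eb Eb'; have := expf_neq0 n w0; have := expf_neq0 n' w0.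
by move: (w ^+ n) (w ^+ n') => v v' v'0 v0; field; rewrite v0 v'0 phib'0.
Qed.

Variables (I : finType) (alpha : I -> K) (lambda : I -> nat) (l : I) (m : nat).
Hypotheses (alpha_inj : injective alpha) (a_alpha : a = alpha l) (m_gt0 : (0 < m)%N).
Local Notation lambda0 := (\sum_k lambda k)%N.

(** The values of [w] at the roots [alpha k] of the polynomial defining the curve; the
    place at infinity of the line, where [w] vanishes, takes over the index [l]. *)
Definition inv_root (k : I) : K := if k == l then 0 else (alpha k - a)^-1.

Definition inv_const : K := \prod_k if k == l then 1 else (a - alpha k) ^+ lambda k.

Lemma alpha_sub_neq0 k : k != l -> alpha k - a != 0.
Proof. by move=> kl; rewrite subr_eq0 a_alpha; apply: contra_neq kl => /alpha_inj. Qed.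

Lemma inv_root_inj : injective inv_root.
Proof.
move=> k k'; rewrite /inv_root.
case: (eqVneq k l) => [->|kl]; case: (eqVneq k' l) => [->|k'l] //.
- by move=> /esym/eqP; rewrite invr_eq0 (negPf (alpha_sub_neq0 k'l)).
- by move=> /eqP; rewrite invr_eq0 (negPf (alpha_sub_neq0 kl)).
- by move=> /invr_inj/addIr/alpha_inj.
Qed.

Lemma inv_const_neq0 : inv_const != 0.
Proof.
apply/prodf_neq0 => k _; have [_|kl] := eqVneq k l; first exact: oner_neq0.
by rewrite expf_neq0 // -opprB oppr_eq0 alpha_sub_neq0.
Qed.

Lemma emb_factor k : emb ('X - (alpha k)%:P) * w =
  if k == l then 1 else phi ((a - alpha k)%:P * ('X - (inv_root k)%:P)).
Proof.
rewrite emb_linear mulfVK ?inv_coord_neq0 //.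
have [->|kl] := eqVneq k l; first by rewrite a_alpha subrr mul0r subr0 rmorph1.
congr (phi _); rewrite /inv_root (negPf kl) mulrBr -polyCM.
have -> : (a - alpha k) * (alpha k - a)^-1 = -1.
  by rewrite -opprB mulNr divff // alpha_sub_neq0.
by rewrite polyCN opprK addrC -[in RHS]opprB polyCN mulNr.
Qed.

(** Multiplying [y] by [w ^+ lambda0] clears the denominators that the change of
    coordinate introduces in the equation of the curve. *)
Lemma emb_curve :
  emb (\prod_k ('X - (alpha k)%:P) ^+ lambda k) * w ^+ (m * lambda0) =
  phi (inv_const *: root_prod inv_root (pole_mult m lambda l lambda0)).
Proof.
have -> : (m * lambda0 = lambda0 + (m - 1) * lambda0)%N.
  by rewrite -mulSn subn1 prednK.
rewrite exprD mulrA -[w ^+ lambda0]prodrXr rmorph_prod -big_split /=.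
rewrite -mul_polyC rmorphM poly_inC /inv_const /root_prod.
rewrite !rmorph_prod -[RHS]big_split /=.
rewrite (bigD1 l) //= [RHS](bigD1 l) //= !eqxx /pole_mult eqxx /inv_root eqxx.
rewrite rmorphXn -exprMn emb_factor eqxx expr1n mul1r mulrC; congr (_ * _).
  by rewrite polyC1 rmorph1 mul1r subr0 rmorphXn poly_inX.
apply: eq_bigr => k kl; rewrite rmorphXn -exprMn emb_factor (negPf kl).
rewrite rmorphM exprMn poly_inC /inv_root (negPf kl) [in RHS]rmorphXn /=.
by rewrite !rmorphXn.
Qed.

End LocalCoordinate.

(** Polynomials in [y] are polynomials in [Y], and these can be reduced modulo
    ['X^m - g]. *)
Lemma kummer_generator (E : fieldType) (F : fieldExtType E) (m : nat)
    (y Y : F) (s g : E) :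
    (0 < m)%N -> <<1; y>>%VS = fullv -> s != 0 -> Y = y * s%:A -> Y ^+ m = g%:A ->
  forall z : F, exists2 p : {poly E}, (size p <= m)%N & z = (map_poly (in_alg F) p).[Y].
Proof.
move=> m0 gen s0 EY Ym z.
have /Fadjoin_polyP[_ /polyOver1P[p ->] Ez] : z \in <<1; y>>%VS by rewrite gen memvf.
have Ey : y = (map_poly (in_alg F) (s^-1 *: 'X)).[Y].
  rewrite map_polyZ map_polyX hornerZ hornerX EY /= scalarV mulrC mulfK //.
  by rewrite scalar_eq0.
pose N : {poly E} := 'X^m - g%:P.
have szN : size N = m.+1 by rewrite size_XnsubC.
have NY : (map_poly (in_alg F) N).[Y] = 0.
  by rewrite rmorphB /= map_polyXn map_polyC !hornerE Ym subrr.
exists ((p \Po (s^-1 *: 'X)) %% N).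
  by rewrite -ltnS -szN ltn_modp -size_poly_eq0 szN.
rewrite Ez {1}Ey -horner_comp -map_comp_poly {1}(divp_eq (p \Po _) N).
by rewrite rmorphD rmorphM hornerD hornerM NY mulr0 add0r.
Qed.

Theorem proposition4p2
  (p : nat) (Fq : finFieldType) (charFq : p \in [pchar Fq])
  (K : closedFieldType) (iota : {rmorphism Fq -> K})
  (Kclosure : is_algebraic_closure iota)
  (r : nat) (alpha : 'I_r -> K) (alpha_inj : injective alpha)
  (m : nat) (m_gt0 : (0 < m)%N) (p_ndvd_m : ~~ (p %| m)%N)
  (lambda : 'I_r -> nat) (lambda_bd : forall k, (1 <= lambda k < m)%N)
  (lambda0 : nat) (lambda0E : lambda0 = (\sum_(k < r) lambda k)%N)
  (m_lambda0 : coprime m lambda0)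
  (F : fieldExtType (ratfun K)) (y : F)
  (F_gen : <<1; y>>%VS = fullv)
  (curve : y ^+ m =
     (ratfun_of_poly (\prod_(k < r) ('X - (alpha k)%:P) ^+ lambda k))%:A)
  (l : 'I_r) (m_lambdal : coprime m (lambda l))
  (lam : nat) (lam_bd : (1 <= lam <= m - 1)%N)
  (lam_inv : (lam * lambda l = 1 %[mod m])%N)
  (P : place (ratfun_const K))
  (P_zero : is_zero P (ratfun_of_poly ('X - (alpha l)%:P)))
  (Q : place (in_alg F \o ratfun_const K)) (Q_over_P : lies_over Q P) :
  gap_set Q =
  [set n : nat | exists i j : int,
     [/\ 1 <= i <= m%:Z - 1,
         0 <= j <= (\sum_(k < r)
                      Num.ceil ((i * lam%:Z * (lambda k)%:Z)%:~R / m%:R : rat))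
                   - Num.ceil ((i * lam%:Z * lambda0%:Z)%:~R / m%:R : rat) - 1
       & n%:Z = i + m%:Z * j]].
Proof.
have m_gt1 : (1 < m)%N by have /andP[l1 lm] := lambda_bd l; exact: leq_ltn_trans lm.
have mK : m%:R != 0 :> K.
  have charK : p \in [pchar K] by rewrite (fmorph_pchar iota).
  by rewrite -(dvdn_pcharf charK).
set a := alpha l in P_zero *.
set emb : {rmorphism {poly K} -> ratfun K} := @tofrac {poly K}.
have emb_inj : injective emb by move=> g g' /eqP; rewrite tofrac_eq => /eqP.
pose w := inv_coord emb a.
have w0 : w != 0 := inv_coord_neq0 emb_inj a.
have nOw : ~ place_ring Q w%:A.
  rewrite scalarV; apply: ideal_not_inv; first exact/Q_over_P/valuation_gt0_ideal.
  by rewrite scalar_eq0 tofrac_eq0 polyXsubC_eq0.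
pose beta := inv_root a alpha l; pose c := inv_const a alpha lambda l.
pose mu := pole_mult m lambda l lambda0.
have beta_inj : injective beta by exact: inv_root_inj.
have c0 : c != 0 by exact: inv_const_neq0.
have wgen : generates (emb \o polyC) w.
  by apply: inv_coord_generates => // h; exact: tofrac_surj.
pose Y : F := y * (w ^+ lambda0)%:A.
have Ycurve : Y ^+ m = (poly_in (emb \o polyC) w (c *: root_prod beta mu))%:A.
  rewrite /Y exprMn curve -scalarX -scalarM -exprM mulnC /mu lambda0E; congr (_%:A).
  exact: emb_curve.
have Ygen := kummer_generator m_gt0 F_gen (expf_neq0 lambda0 w0) (erefl Y) Ycurve.
have mD : coprime m (\sum_k mu k).
  exact: (coprime_sum_pole_mult m_gt1 lambda0E lam_inv).
have semigroupE n := pole_semigroupE mK c0 beta_inj mD Ycurve wgen Ygen nOw n.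
apply/funext => n; apply/propext.
have gapE := pole_gapE m_gt1 lambda0E m_lambda0 lam_inv n.
have boundE (i : nat) :
    \sum_(k < r) Num.ceil ((i%:Z * lam%:Z * (lambda k)%:Z)%:~R / m%:R : rat)
    - Num.ceil ((i%:Z * lam%:Z * lambda0%:Z)%:~R / m%:R : rat) =
    gap_bound m lambda lambda0 lam i.
  rewrite /gap_bound /cdiv !PoszM ceil_ratio //; congr (_ - _).
  by apply: eq_bigr => k _; rewrite ceil_ratio // !PoszM.
have -> : gap_set Q n = ~ (exists i d : nat, (i < m)%N /\
    (n + m * \sum_k i * mu k %/ m = i * \sum_k mu k + m * d)%N).
  by congr (~ _); exact/propext/semigroupE.
apply: iff_trans gapE _; split=> -[i [j [ilt jlt En]]];
  case: i ilt jlt En => // i ilt jlt En; exists i%:Z, j; split=> //.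
  by rewrite boundE.
by rewrite -boundE.
Qed.
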